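(* Let $n\in\mathbb{N}$, let $\Lambda$ be a parameter shift from $\lambda_-$ to $\lambda_+$, and let $(X(s),\Lambda(s))$ be a stable path with $X_\pm=\lim_{s\to\pm\infty}X(s)$. (1) If there is another stable path $(Y(s),\Lambda(s))$ with $Y_\pm=\lim_{s\to\pm\infty}Y(s)$ such that $Y_+\neq X_+$, and there are real numbers $u<v$ such that $X(u)\in\mathbb{B}(Y(v),\Lambda(v))$, then $(X(s),\Lambda(s))$ is not forward basin stable, and there is a parameter shift $\tilde\Lambda$ which is a re-scaling of $\Lambda$ such that there is R-tipping away from $X_-$ for $\tilde\Lambda$. (2) If there is a $Y_+\neq X_+$ such that $Y_+$ is an attracting equilibrium of $\dot x=f(x,\lambda_+)$ and $X_-\in\mathbb{B}(Y_+,\lambda_+)$, then $(X(s),\Lambda(s))$ is not forward basin stable, and there is R-tipping away from $X_-$ for $\Lambda$.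
   Context: Setting. $U\subset\mathbb{R}^n$ is open and $f\in C^2(U\times\mathbb{R},\mathbb{R}^n)$. For fixed $\lambda$ consider the autonomous system $\dot x=f(x,\lambda)$. Let $\lambda_-<\lambda_+$. A parameter shift (from $\lambda_-$ to $\lambda_+$) is a function $\Lambda\in C^2(\mathbb{R},(\lambda_-,\lambda_+))$ with $\lim_{s\to\pm\infty}\Lambda(s)=\lambda_\pm$ and $\lim_{s\to\pm\infty}\Lambda'(s)=0$. For $r>0$ consider the non-autonomous system $\dot x=f(x,\Lambda(rt))$, equivalently the augmented system $\dot x=f(x,\Lambda(s))$, $\dot s=r$ with $s=rt$. Attracting equilibrium: an equilibrium of $\dot x=f(x,\lambda)$ at which all eigenvalues of $\partial_xf$ have negative real part. $\mathbb{B}(p,\lambda)$ denotes the basin of attraction in $U$ of an attracting equilibrium $p$ of $\dot x=f(x,\lambda)$. Stable path: $(X(s),\Lambda(s))$, $s\in\mathbb{R}$, with $X$ continuous, $X(s)\in U$ an attracting equilibrium of $\dot x=f(x,\Lambda(s))$ for every $s$, and such that the limits $X_\pm=\lim_{s\to\pm\infty}X(s)$ exist in $U$ and are attracting equilibria of $\dot x=f(x,\lambda_\pm)$. Forward basin stable: $(X(s),\Lambda(s))$ is forward basin stable if $\overline{\{X(u):u<s\}}\subset\mathbb{B}(X(s),\Lambda(s))$ for all $s\in\mathbb{R}$. Pullback attractor: for each $r>0$ there is a unique trajectory $x^r(t)$ of $\dot x=f(x,\Lambda(rt))$ with $x^r(t)\to X_-$ as $t\to-\infty$; it is called the pullback attractor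 to $X_-$. R-tipping: there is R-tipping away from $X_-$ for a parameter shift if for some $r>0$ the corresponding pullback attractor $x^r$ to $X_-$ does not satisfy $x^r(t)\to X_+$ as $t\to\infty$. Re-scaling: $\tilde\Lambda$ is a re-scaling of $\Lambda$ if $\tilde\Lambda(s)=\Lambda(\sigma(s))$ for some monotonically increasing $\sigma\in C^2(\mathbb{R},\mathbb{R})$. *)

(* Defs.v *)
From mathcomp Require Import all_boot all_order all_algebra.
From mathcomp Require Import complex.
From mathcomp Require Import all_classical all_reals all_analysis.

Set Implicit Arguments.
Unset Strict Implicit.
Unset Printing Implicit Defensive.

Import Order.TTheory GRing.Theory Num.Theory.
Import numFieldNormedType.Exports.

Local Open Scope classical_set_scope.
Local Open Scope ring_scope.

(* [Ck k A g]: [g] is of class C^k on the open set [A]. For finite-dimensional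
   [V], continuity of all directional derivatives is continuity of the
   differential. *)
Fixpoint Ck (R : realType) (V W : normedModType R) (k : nat) (A : set V)
    (g : V -> W) : Prop :=
  if k is k'.+1 then
    (forall x, A x -> differentiable g x) /\
    (forall v, Ck k' A (fun x => 'D_v g x))
  else forall x, A x -> {for x, continuous g}.

Section RateInducedTipping.
Context {R : realType} {n : nat}.
Local Notation V := 'rV[R]_n.

(* Solutions on the open interval ]a, b[ of x' = F(x, t) staying in [U]; the
   values of [x] outside ]a, b[ are irrelevant. *)
Definition trajectory (U : set V) (F : V -> R -> V) (a b : \bar R)
    (x : R -> V) : Prop :=
  forall t : R, (a < t%:E)%E -> (t%:E < b)%E ->
    U (x t) /\ is_derive t 1 x (F (x t) t).

(* The library's Jacobian acts on row vectors on the right, i.e. it is the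
   transpose of the usual one; the eigenvalues are the same. *)
Definition attracting_equilibrium (U : set V) (f : V -> R -> V) (p : V)
    (lambda : R) : Prop :=
  [/\ U p, f p lambda = 0 &
    forall mu : R[i],
      eigenvalue (map_mx (real_complex R) ('J (f^~ lambda) p)) mu ->
      complex.Re mu < 0].

(* A solution defined for all t >= 0 of a smooth system on an open set extends
   to ]a, +oo[ for some a < 0, so no one-sided derivative at 0 is needed. *)
Definition basin (U : set V) (f : V -> R -> V) (p : V) (lambda : R) : set V :=
  [set x0 | exists (a : R) (x : R -> V),
    [/\ a < 0, trajectory U (fun y _ => f y lambda) a%:E +oo%E x, x 0 = x0 &
        x t @[t --> +oo] --> p]].

Definition parameter_shift (lm lp : R) (Lambda : R -> R) : Prop :=
  [/\ @Ck R R R 2 setT Lambda,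
      forall s, lm < Lambda s < lp,
      Lambda s @[s --> -oo] --> lm,
      Lambda s @[s --> +oo] --> lp &
      Lambda^`()%classic s @[s --> -oo] --> (0 : R) /\
      Lambda^`()%classic s @[s --> +oo] --> (0 : R)].

Definition stable_path (U : set V) (f : V -> R -> V) (Lambda : R -> R)
    (lm lp : R) (X : R -> V) (Xm Xp : V) : Prop :=
  [/\ continuous X,
      forall s, attracting_equilibrium U f (X s) (Lambda s),
      X s @[s --> -oo] --> Xm /\ X s @[s --> +oo] --> Xp,
      attracting_equilibrium U f Xm lm &
      attracting_equilibrium U f Xp lp].

Definition forward_basin_stable (U : set V) (f : V -> R -> V)
    (Lambda : R -> R) (X : R -> V) : Prop :=
  forall s : R,
    closure [set X u | u in [set u | u < s]] `<=` basin U f (X s) (Lambda s).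

(* Solutions may leave [U] or blow up in finite time, so the pullback attractor
   is the maximal trajectory, on some ]-oo, T[, tending to [Xm] at -oo. *)
Definition pullback_attractor (U : set V) (f : V -> R -> V) (Lambda : R -> R)
    (r : R) (Xm : V) (T : \bar R) (x : R -> V) : Prop :=
  let F := fun y t => f y (Lambda (r * t)) in
  [/\ (-oo < T)%E,
      trajectory U F -oo%E T x,
      x t @[t --> -oo] --> Xm &
      forall (T' : \bar R) (y : R -> V), (T <= T')%E ->
        trajectory U F -oo%E T' y ->
        (forall t : R, (t%:E < T)%E -> y t = x t) -> T' = T].

Definition R_tipping (U : set V) (f : V -> R -> V) (Lambda : R -> R)
    (Xm Xp : V) : Prop :=
  exists (r : R) (T : \bar R) (x : R -> V),
    [/\ 0 < r, pullback_attractor U f Lambda r Xm T x &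
        ~ (T = +oo%E /\ x t @[t --> +oo] --> Xp)].

Definition rescaling (Lambda' Lambda : R -> R) : Prop :=
  exists sigma : R -> R,
    [/\ @Ck R R R 2 setT sigma, {homo sigma : s t / s < t} &
        forall s, Lambda' s = Lambda (sigma s)].

End RateInducedTipping.

(* Main.v *)
(* Near an attracting equilibrium the Lyapunov form of the linearisation makes
   the vector field one-sided contracting, for all nearby parameter values; this
   yields trapping neighbourhoods, uniqueness of nearby equilibria and, by a fixed
   point argument, a solution emanating from X_- at time -oo.

   If X(u) lies in the basin of Y(v) and X were forward basin stable, then
   X(v) = Y(v), and local uniqueness of equilibria would force X = Y from v on,
   so X_+ = Y_+. Rescale Lambda so that it moves slowly up to u, jumps almost to v,
   and moves slowly afterwards: the pullback attractor follows X up to u, hardly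
   moves during the jump, is attracted to Y(v), then follows Y and ends up trapped
   near Y_+, so it cannot tend to X_+. In the second part a large rate r plays the
   role of the jump, directly from X_- to the basin of Y_+. *)

Require Import Defs.
From mathcomp Require Import all_boot all_order all_algebra.
From mathcomp Require Import spectral complex.
From mathcomp Require Import ring lra.
From mathcomp Require Import all_classical all_reals all_analysis.

Import Order.TTheory GRing.Theory Num.Theory.
Import numFieldNormedType.Exports.
Local Open Scope classical_set_scope.
Local Open Scope ring_scope.

Set Implicit Arguments.
Unset Strict Implicit.
Unset Printing Implicit Defensive.

(** * Real functions *)

(** A pullback attractor may blow up or leave [U]; its maximal time is then finite and [R_tipping]
    holds at once. So only trajectories defined on all of R have to be followed, and the tracking
    estimates speak of an arbitrary given solution: for each e there is d such that any solution
    starting within d of a reference ends within e of it. Such statements compose; hence the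
    constants of the tipping lemmas are chosen backwards, from Y_+ to X_-, and compactness of a
    segment also enters through composition.

    Closeness is propagated by barriers: a first arrival on a level set of a quadratic form is
    contradicted. The form has to be adapted to the linearisation, because in a fixed norm an
    attracting linear field may first expand. Stable paths are only assumed continuous; their
    Lipschitz bound comes from contraction and from the smoothness of the shift.

    The delicate end is time -oo. A solution bounded in the past is controlled by a decay inequality
    read backwards, and Lambda' -> 0 gives a uniform Lipschitz bound on a half-line, where
    compactness does not reach. *)

(** Real induction: the supremum of the points reached from [a] can be passed by the local
    hypothesis unless it is [b]. In most uses [T a b] is itself a quantified statement about the
    segment from [a] to [b], and transitivity merges the constants, in place of a finite
    subcover. *)
Lemma chain_segment (R : realType) (T : R -> R -> Prop) (a b : R) :
  a <= b ->
  (forall x y z, a <= x -> x <= y -> y <= z -> z <= b ->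
     T x y -> T y z -> T x z) ->
  (forall s, a <= s -> s <= b -> exists2 e, 0 < e &
     forall x y, a <= x -> x <= y -> y <= b ->
       `|x - s| < e -> `|y - s| < e -> T x y) ->
  T a b.
Proof.
move=> ab trT locT.
pose A : set R := [set x | a <= x <= b /\ T a x].
have Taa : T a a.
  have [e e0 Te] := locT a (lexx a) ab.
  by apply: Te; rewrite ?subrr ?normr0.
have A0 : A a by split; rewrite ?lexx.
have Aub : ubound A b by move=> x [/andP[_ ?] _].
have hA : has_sup A by split; [exists a | exists b].
have sa : a <= sup A by apply: ub_le_sup => //; exists b.
have sb : sup A <= b by apply: sup_le_ub => //; exists a.
have [e e0 Te] := locT _ sa sb.
have [x [/andP[ax xb] Tax] xs] := sup_adherent e0 hA.
have xsA : x <= sup A by apply: ub_le_sup; [exists b | split; rewrite ?ax].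
pose y := Num.min b (sup A + e / 2).
have sy : sup A <= y by rewrite le_min sb lerDl; lra.
have yb : y <= b by rewrite ge_min lexx.
have yse : y <= sup A + e / 2 by rewrite ge_min lexx orbT.
have Tay : T a y.
  apply: (trT _ x); rewrite ?lexx ?(le_trans xsA sy) //.
  apply: Te; rewrite ?(le_trans xsA sy) // ltr_norml; lra.
have Ay : A y by split; rewrite // yb (le_trans sa).
have : y <= sup A by apply: ub_le_sup => //; exists b.
rewrite /y ge_min => /orP[bs|]; last by lra.
suff <- : y = b by [].
by apply/le_anti; rewrite yb (le_trans bs sy).
Qed.

Lemma continuous_distP (R : realType) (V W : normedModType R) (g : V -> W) x :
  {for x, continuous g} <->
  forall e, 0 < e -> exists2 d, 0 < d &
    forall y, `|y - x| < d -> `|g y - g x| < e.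
Proof.
split=> [/cvgrPdist_lt cg e e0|cg].
  have /nbhs_ballP[d /= d0 dg] := cg e e0.
  exists d => // y yx; rewrite distrC; apply: dg.
  by rewrite -ball_normE /ball_/= distrC.
apply/cvgrPdist_lt => e e0; have [d d0 dg] := cg e e0.
apply/nbhs_ballP; exists d => //= y; rewrite -ball_normE /ball_/= => xy.
by rewrite distrC; apply: dg; rewrite distrC.
Qed.

(** A first time at which [W] reaches [e] would be preceded by times at or above [e]. Only
    continuity of [W] is asked: the squared distance to a moving equilibrium may fail to be
    differentiable. *)
Lemma barrier (R : realType) (W : R -> R) (e a b : R) :
  (forall t, a <= t -> t <= b -> {for t, continuous W}) ->
  W a < e ->
  (forall t, a < t -> t <= b -> W t = e -> forall s, a <= s -> s < t ->
     exists2 t', s < t' < t & e <= W t') ->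
  forall t, a <= t -> t <= b -> W t < e.
Proof.
move=> cW Wa back t0 at0 t0b; rewrite ltNge; apply/negP => eWt0.
pose A : set R := [set t | a <= t <= b /\ e <= W t].
have A0 : A t0 by split; rewrite ?at0.
have hA : has_inf A by split; [exists t0 | exists a => x [/andP[]]].
have lbA : has_lbound A by case: hA.
pose s := inf A.
have sa : a <= s by apply: lb_le_inf; [exists t0 | move=> x [/andP[]]].
have sb : s <= b by rewrite (le_trans _ t0b)// ge_inf.
have below t : a <= t -> t < s -> W t < e.
  move=> at_ ts; rewrite ltNge; apply/negP => eW.
  have /(ge_inf lbA) : A t by split; rewrite // at_ (le_trans (ltW ts)).
  by rewrite leNgt ts.
have eWs : e <= W s.
  rewrite leNgt; apply/negP => Wse.
  have /continuous_distP/(_ (e - W s)) := cW _ sa sb.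
  rewrite subr_gt0 => /(_ Wse)[d d0 dW].
  have [x [/andP[ax xb] ex]] := inf_adherent d0 hA; rewrite -/s => xsd.
  have sx : s <= x by apply: ge_inf => //; split; rewrite ?ax.
  have /dW : `|x - s| < d by rewrite ltr_norml; lra.
  rewrite ltr_norml; lra.
have as_ : a < s.
  by rewrite lt_neqAle sa andbT; apply/eqP => eas; move: Wa; rewrite eas; lra.
have Wse : W s = e.
  apply/le_anti; rewrite eWs andbT leNgt; apply/negP => Wse.
  have /continuous_distP/(_ (W s - e)) := cW _ sa sb.
  rewrite subr_gt0 => /(_ Wse)[d d0 dW].
  pose x := Num.max a (s - d / 2).
  have ax : a <= x by rewrite le_max lexx.
  have xs : x < s by rewrite gt_max as_/=; lra.
  have xd : s - d / 2 <= x by rewrite le_max lexx orbT.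
  have /dW : `|x - s| < d by rewrite ltr_norml; lra.
  rewrite ltr_norml; have := below _ ax xs; lra.
have [t' /andP[at' t's]] := back _ as_ sb Wse _ (lexx a) as_.
by rewrite leNgt below // ltW.
Qed.

Lemma is_derive_distP (R : realType) (W : normedModType R) (g : R -> W) (t : R) (d : W) :
  is_derive t 1 g d <->
  forall e, 0 < e -> exists2 r, 0 < r &
    forall s, `|s - t| < r -> `|g s - g t - (s - t) *: d| <= e * `|s - t|.
Proof.
have cvgE : (fun h : R => h^-1 *: ((g \o shift t) (h *: (1 : R)) - g t)) @ 0^' --> d <->
  forall e, 0 < e -> exists2 r, 0 < r &
    forall s, `|s - t| < r -> `|g s - g t - (s - t) *: d| <= e * `|s - t|.
  split=> [/cvgrPdist_le cg e e0|cg].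
    have [r /= r0 rg] := cg e e0; exists r => // s str.
    have [->|st0] := eqVneq s t; first by rewrite !subrr scale0r subr0 !normr0 mulr0.
    have st : s - t != 0 by rewrite subr_eq0.
    have := rg (s - t); rewrite /ball_/= sub0r normrN => /(_ str st).
    rewrite /shift/= [_ *: 1]mulr1 subrK => le_e.
    rewrite -(ler_pM2r (_ : 0 < `|s - t|)) ?normr_gt0// in le_e.
    apply: le_trans le_e; rewrite mulrC -normrZ scalerBr scalerA divff// scale1r.
    by rewrite distrC.
  apply/cvgrPdist_le => e e0; have [r r0 rg] := cg e e0.
  exists r => //= h; rewrite /ball_/= sub0r normrN => hr h0.
  have := rg (h + t); rewrite addrK => /(_ hr).
  rewrite /shift/= [_ *: 1]mulr1 => le_e.
  rewrite -(ler_pM2r (_ : 0 < `|h|)) ?normr_gt0//.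
  apply: le_trans le_e; rewrite mulrC -normrZ scalerBr scalerA divff// scale1r.
  by rewrite distrC.
split=> [[dg dE]|dg]; first by apply/cvgE; rewrite -dE; exact: dg.
have {}dg := cvgE.2 dg; split; last exact: cvg_lim.
by apply/cvg_ex; exists d.
Qed.

Lemma is_derive_continuous (R : realType) (W : normedModType R) (g : R -> W) (t : R) (d : W) :
  is_derive t 1 g d -> {for t, continuous g}.
Proof. by move=> [dg _]; exact/differentiable_continuous/derivable1_diffP. Qed.

Lemma MVT_is_derive (R : realType) (g dg : R -> R) (a b : R) : a <= b ->
  (forall t, a <= t -> t <= b -> is_derive t 1 g (dg t)) ->
  exists2 c, a <= c <= b & g b - g a = dg c * (b - a).
Proof.
move=> ab gd; have [|t|c cab ->] := @MVT_segment R g dg a b ab.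
- by move=> x; rewrite in_itv/= => /andP[ax xb]; apply: gd; exact: ltW.
- apply: continuous_in_subspaceT => x; rewrite inE/= in_itv/= => /andP[ax xb].
  exact: is_derive_continuous (gd _ ax xb).
- by exists c; rewrite ?in_itv// in cab *.
Qed.

Lemma is_derive_nincr (R : realType) (g dg : R -> R) (a b : R) : a <= b ->
  (forall t, a <= t -> t <= b -> is_derive t 1 g (dg t)) ->
  (forall t, a <= t -> t <= b -> dg t <= 0) -> g b <= g a.
Proof.
move=> ab gd dg0; have [c /andP[ac cb] gE] := MVT_is_derive ab gd.
by rewrite -subr_le0 gE mulr_le0_ge0 ?dg0 ?subr_ge0.
Qed.

(** A negative derivative on the level [e] puts [W] above [e] just before, which is what [barrier]
    forbids at a first arrival. *)
Lemma barrier_derive (R : realType) (W dW : R -> R) (e a b : R) :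
  (forall t, a <= t -> t <= b -> is_derive t 1 W (dW t)) ->
  W a < e ->
  (forall t, a <= t -> t <= b -> W t = e -> dW t < 0) ->
  forall t, a <= t -> t <= b -> W t < e.
Proof.
move=> Wd Wa We; apply: barrier => // [t at_ tb|t at_ tb Wte s as_ st].
  exact: is_derive_continuous (Wd _ at_ tb).
have dW0 := We _ (ltW at_) tb Wte.
have /is_derive_distP/(_ (- dW t / 2)) := Wd _ (ltW at_) tb.
case=> [|r r0 rW]; first by lra.
pose t' := Num.max ((s + t) / 2) (t - r / 2).
have t't : t' < t by rewrite gt_max; lra.
have st' : s < t' by rewrite lt_max; lra.
have rt' : t - r / 2 <= t' by rewrite le_max lexx orbT.
exists t'; rewrite ?st'//.
have /rW : `|t' - t| < r by rewrite ltr_norml; lra.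
rewrite Wte [`|t' - t|]ltr0_norm ?subr_lt0// => /ler_normlP[].
rewrite /GRing.scale/= => W1 _.
have : 0 < (t - t') * (- dW t) by rewrite mulr_gt0; lra.
nra.
Qed.

(** The product of [expR (c * s)] and [W s - m] is nonincreasing, and since [W] is bounded above its
    upper limit at -oo is at most 0; a positive value at [t] would contradict this. *)
Lemma backward_bounded_le (R : realType) (W dW : R -> R) (c m B t1 : R) :
  0 < c ->
  (forall t, t < t1 -> is_derive t 1 W (dW t)) ->
  (forall t, t < t1 -> dW t <= - c * (W t - m)) ->
  (forall t, t < t1 -> W t <= B) ->
  forall t, t < t1 -> W t <= m.
Proof.
move=> c0 Wd dWle WB t tt1; rewrite leNgt; apply/negP => mWt.
pose E s := expR (c * s) * (W s - m).
have Emono s : s <= t -> E t <= E s.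
  move=> st; pose dE u := expR (c * u) * (c * (W u - m) + dW u).
  apply: (@is_derive_nincr _ E dE) => // u su ut.
    have ut1 := le_lt_trans ut tt1; have Wu := Wd _ ut1.
    rewrite /E /dE; apply: is_derive_eq; rewrite !scaler1 /GRing.scale/=; ring.
  have ut1 := le_lt_trans ut tt1; have := dWle _ ut1.
  by rewrite /dE pmulr_rle0 ?expR_gt0//; lra.
have Et0 : 0 < E t by rewrite mulr_gt0 ?expR_gt0 ?subr_gt0.
pose D := Num.max 1 (B - m).
have D0 : 0 < D by rewrite lt_max ltr01.
have [s st sE] : exists2 s, s <= t & expR (c * s) * D < E t.
  (* Early enough for [expR (c * s) * D] to be at most half of [E t]. *)
  pose s := Num.min t (ln (E t / D / 2) / c).
  have s1 : s <= t by rewrite ge_min lexx.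
  have s2 : s <= ln (E t / D / 2) / c by rewrite ge_min lexx orbT.
  exists s => //; rewrite -ltr_pdivlMr//.
  apply: (@le_lt_trans _ _ (E t / D / 2)).
    rewrite -[leRHS]lnK ?ler_expR ?posrE ?divr_gt0//.
    by rewrite mulrC -ler_pdivlMr.
  by have : 0 < E t / D by [rewrite divr_gt0]; lra.
have := lt_le_trans sE (Emono _ st).
rewrite ltNge => /negP; apply.
rewrite ler_pM2l ?expR_gt0// le_max; apply/orP; right.
by rewrite lerB// WB// (le_lt_trans st).
Qed.

(** The integral from [- a] is differentiable only to the right of [- a]. Normalised to vanish at 0,
    the functions [H a] agree where they overlap, so the lower bound can move with [x]. *)
Lemma antiderivative (R : realType) (g : R -> R) : continuous g ->
  exists A : R -> R, forall t : R, is_derive t 1 A (g t).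
Proof.
move=> cg.
pose F a x := (\int[lebesgue_measure]_(t in [set` `[- a, x]%R]) g t)%R : R.
have dF (a x : R) : - a < x -> is_derive x 1 (F a) (g x).
  move=> ax; have xx : x < x + 1 by rewrite ltrDl.
  have [|||d1 d2] := @continuous_FTC1_closed R g (- a) x _ xx.
  - apply: continuous_compact_integrable; first exact: segment_compact.
    exact: continuous_subspaceT.
  - exact: ax.
  - exact: cg.
  by apply: DeriveDef; [exact: d1 | rewrite -derive1E].
pose H a x := F a x - F a 0.
have dH (a x : R) : - a < x -> is_derive x 1 (H a) (g x).
  by move=> /dF dFx; rewrite -[g x]subr0; apply: is_deriveB.
have HE a b x : 0 < a -> 0 < b -> - a < x -> - b < x -> H a x = H b x.
  move=> a0 b0 ax bx; pose m := Num.min 0 x; pose k := Num.max 0 x.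
  have mk : m <= k by rewrite le_max ge_min lexx.
  have am : - a < m by rewrite lt_min ax andbT oppr_lt0.
  have bm : - b < m by rewrite lt_min bx andbT oppr_lt0.
  have dHH t : m <= t -> t <= k -> is_derive t 1 (fun y => H a y - H b y) 0.
    move=> mt tk; rewrite -(subrr (g t)).
    by apply: is_deriveB; apply: dH; exact: lt_le_trans mt.
  have [c _ ] := MVT_is_derive mk dHH; rewrite mul0r => /eqP.
  rewrite subr_eq0 => /eqP; rewrite /k /m.
  have H0 c' : H c' 0 = 0 by rewrite /H subrr.
  case: (leP 0 x) => x0; rewrite ?(max_idPr x0) ?(max_idPl (ltW x0)) ?(min_idPl x0)
    ?(min_idPr (ltW x0)) !H0 subrr.
    by move/eqP; rewrite subr_eq0 => /eqP.
  by move/esym/eqP; rewrite subr_eq0 => /eqP.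
exists (fun x => H (`|x| + 1) x) => x.
have x2 : - (`|x| + 2) < x by have := ler_norm (- x); rewrite normrN; lra.
apply: near_eq_is_derive (dH _ _ x2).
apply/nbhs_ballP; exists 1 => //= y; rewrite -ball_normE /ball_/= => xy.
have yx : `|y| <= `|x| + 1.
  by rewrite -[y](subrK x) addrC (le_trans (ler_normD _ _))// lerD2l distrC ltW.
have := ler_norm (- y); have := ler_norm (- x); rewrite !normrN => ? ?.
by apply: HE; have := normr_ge0 x; have := normr_ge0 y; lra.
Qed.

(** [z t] is the integral of K exp(K (s - t)) g(s) over s <= t, an average of [g], whence the same
    bound [M]. The limit [l] at -oo of the antiderivative [A] is obtained as an infimum: A - M exp(K
    s) is nonincreasing and A + M exp(K s) is nondecreasing. *)
Lemma bounded_relaxation (R : realType) (K M : R) (g : R -> R) : 0 < K ->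
  continuous g -> (forall t, `|g t| <= M) ->
  exists z : R -> R, (forall t : R, is_derive t 1 z (K * (g t - z t))) /\
    forall t, `|z t| <= M.
Proof.
move=> K0 cg gM.
have dexp (t : R) : is_derive t 1 (fun s => expR (K * s)) (K * expR (K * t)).
  by apply: is_derive_eq; rewrite scaler1 /GRing.scale/= mulrC.
have [|A dA] := @antiderivative R (fun s => K * expR (K * s) * g s).
  move=> t; apply: cvgM; last exact: cg.
  apply: cvgM; first exact: cvg_cst.
  exact: is_derive_continuous (dexp t).
have Amono (b s t : R) : s <= t -> b = 1 \/ b = -1 ->
    b * A s - M * expR (K * s) >= b * A t - M * expR (K * t).
  move=> st b1.
  have dAM (u : R) : is_derive u 1 (fun s => b * A s - M * expR (K * s))
      (K * expR (K * u) * (b * g u - M)).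
    by apply: is_derive_eq; rewrite /GRing.scale/=; ring.
  apply: (is_derive_nincr st (fun u _ _ => dAM u)) => u _ _.
  rewrite pmulr_rle0 ?mulr_gt0 ?expR_gt0// subr_le0.
  have := gM u; rewrite ler_norml; case: b1 => ->; lra.
pose P := [set A s + M * expR (K * s) | s in [set: R]].
have lower t s : A t - M * expR (K * t) <= A s + M * expR (K * s).
  have M0 : 0 <= M := le_trans (normr_ge0 _) (gM 0).
  have := mulr_ge0 M0 (expR_ge0 (K * s)); have := mulr_ge0 M0 (expR_ge0 (K * t)).
  have [st|/ltW ts] := leP s t.
    have := Amono 1 _ _ st (or_introl erefl); lra.
  have := Amono (-1) _ _ ts (or_intror erefl); lra.
pose l := inf P.
have lP t : l <= A t + M * expR (K * t).
  by apply: ge_inf; [exists (A 0 - M * expR (K * 0)) => _ [s _ <-] | exists t].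
have Pl t : A t - M * expR (K * t) <= l.
  by apply: lb_le_inf => [|_ [s _ <-]//]; exists (A 0 + M * expR (K * 0)), 0.
exists (fun t => expR (- (K * t)) * (A t - l)); split=> t /=.
  apply: is_derive_eq; rewrite /GRing.scale/= expRN.
  have := lt0r_neq0 (expR_gt0 (K * t)) => e0; by field.
rewrite normrM (gtr0_norm (expR_gt0 _)) expRN ler_pdivrMl ?expR_gt0// mulrC.
by rewrite ler_norml; have := lP t; have := Pl t; lra.
Qed.

(** * Quadratic forms and smoothness of the vector field *)

Section Forms.
Context {R : realType}.

Lemma coord_le_norm n (v : 'rV[R]_n) i : `|v 0 i| <= `|v|.
Proof.
rewrite [leRHS]/Num.Def.normr/= mx_normrE.
exact: (@le_bigmax _ _ _ _ (fun ij => `|v ij.1 ij.2|) (0, i)).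
Qed.

Lemma row_norm_le n (v : 'rV[R]_n) e : 0 <= e ->
  (forall i, `|v 0 i| <= e) -> `|v| <= e.
Proof.
move=> e0 ve; rewrite [leLHS]/Num.Def.normr/= mx_normrE.
by apply: bigmax_le => //= -[i j] _ /=; rewrite ord1.
Qed.

Lemma mulmx_norm_bound n m (M : 'M[R]_(n, m)) :
  exists2 C, 0 < C & forall v : 'rV_n, `|v *m M| <= C * `|v|.
Proof.
pose S := \sum_k \sum_i `|M i k|.
have S0 : 0 <= S by apply: sumr_ge0 => k _; apply: sumr_ge0 => i _.
exists (1 + S) => [|v]; first by lra.
apply: row_norm_le => [|k]; first by rewrite mulr_ge0// addr_ge0.
rewrite mxE (le_trans (ler_norm_sum _ _ _))//.
apply: (@le_trans _ _ (\sum_i `|M i k| * `|v|)).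
  by apply: ler_sum => i _; rewrite normrM mulrC ler_wpM2l ?coord_le_norm.
rewrite -mulr_suml ler_wpM2r//.
rewrite /S (bigD1 k)//=.
have : 0 <= \sum_(i < m | i != k) \sum_(j < n) `|M j i|.
  by apply: sumr_ge0 => j _; apply: sumr_ge0 => i _.
lra.
Qed.

(** The bilinear form of the positive semidefinite matrix M M^T, definite once [M] has a right
    inverse. [M] is rectangular because a complex change of basis is later split into its real and
    imaginary parts. *)
Definition gram n m (M : 'M[R]_(n, m)) (v w : 'rV[R]_n) : R :=
  \sum_k (v *m M) 0 k * (w *m M) 0 k.

Section FormTheory.
Variables (n m : nat) (M : 'M[R]_(n, m)).
Implicit Types v w : 'rV[R]_n.

Lemma gramC v w : gram M v w = gram M w v.
Proof. by apply: eq_bigr => k _; rewrite mulrC. Qed.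

Lemma gramDl v v' w : gram M (v + v') w = gram M v w + gram M v' w.
Proof. by rewrite -big_split; apply: eq_bigr => k _; rewrite mulmxDl mxE mulrDl. Qed.

Lemma gramZl a v w : gram M (a *: v) w = a * gram M v w.
Proof. by rewrite mulr_sumr; apply: eq_bigr => k _; rewrite -scalemxAl mxE mulrA. Qed.

Lemma gramNl v w : gram M (- v) w = - gram M v w.
Proof. by rewrite -scaleN1r gramZl mulN1r. Qed.

Lemma gramBl v v' w : gram M (v - v') w = gram M v w - gram M v' w.
Proof. by rewrite gramDl gramNl. Qed.

Lemma gramDr v w w' : gram M v (w + w') = gram M v w + gram M v w'.
Proof. by rewrite gramC gramDl !(gramC v). Qed.

Lemma gramZr a v w : gram M v (a *: w) = a * gram M v w.
Proof. by rewrite gramC gramZl (gramC v). Qed.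

Lemma gramNr v w : gram M v (- w) = - gram M v w.
Proof. by rewrite gramC gramNl (gramC v). Qed.

Lemma gram0l w : gram M 0 w = 0.
Proof. by rewrite -(scale0r 0) gramZl mul0r. Qed.

Definition gramE := (gramDl, gramDr, gramZl, gramZr, gramNl, gramNr).

Lemma gram_ge0 v : 0 <= gram M v v.
Proof. by apply: sumr_ge0 => k _; rewrite -expr2 sqr_ge0. Qed.

Lemma gram_young e v w : 0 < e ->
  2 * gram M v w <= e * gram M v v + e^-1 * gram M w w.
Proof.
move=> e0; have := gram_ge0 (e *: v - w); rewrite !gramE (gramC w v).
have := lt0r_neq0 e0 => en0 H.
rewrite -(ler_pM2l e0) mulrDr [e * (e^-1 * _)]mulrA divff// mul1r; nra.
Qed.

Lemma gram_bound : exists2 C, 0 < C &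
  forall v w, `|gram M v w| <= C * (`|v| * `|w|).
Proof.
have [C C0 CM] := mulmx_norm_bound M.
exists ((C * C) * (m%:R + 1)) => [|v w].
  by rewrite mulr_gt0 ?mulr_gt0// ltr_wpDl ?ler0n.
have CC0 : 0 <= C * C * (`|v| * `|w|) by rewrite !mulr_ge0// ltW.
apply: (@le_trans _ _ (\sum_(k < m) C * C * (`|v| * `|w|))).
  rewrite (le_trans (ler_norm_sum _ _ _))//; apply: ler_sum => k _.
  rewrite normrM mulrACA; apply: ler_pM => //;
    exact: le_trans (coord_le_norm _ _) (CM _).
by rewrite sumr_const card_ord -mulr_natr; nra.
Qed.

Lemma gram_lower_bound (N : 'M[R]_(m, n)) : M *m N = 1%:M ->
  exists2 C, 0 < C & forall v, `|v| ^+ 2 <= C * gram M v v.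
Proof.
move=> MN; have [C C0 CN] := mulmx_norm_bound N.
exists (C ^+ 2) => [|v]; first by rewrite exprn_gt0.
have -> : v = (v *m M) *m N by rewrite -mulmxA MN mulmx1.
rewrite -mulmxA MN mulmx1.
have h : `|v *m M| <= Num.sqrt (gram M v v).
  apply: row_norm_le => [|k]; first exact: sqrtr_ge0.
  rewrite -sqrtr_sqr ler_sqrt ?gram_ge0// /gram (bigD1 k)//= -expr2 lerDl.
  by apply: sumr_ge0 => j _; rewrite -expr2 sqr_ge0.
have {}h : `|v| <= C * Num.sqrt (gram M v v).
  by rewrite -{1}[v]mulmx1 -MN mulmxA (le_trans (CN _))// ler_pM2l.
rewrite -[gram M v v]sqr_sqrtr ?gram_ge0// -exprMn.
by rewrite ler_pXn2r// nnegrE// mulr_ge0 ?sqrtr_ge0// ltW.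
Qed.

Lemma is_derive_mulmx (x : R -> 'rV[R]_n) (t : R) dx :
  is_derive t 1 x dx -> is_derive t 1 (fun s => x s *m M) (dx *m M).
Proof.
move=> /is_derive_distP dxP; apply/is_derive_distP => e e0.
have [C C0 CM] := mulmx_norm_bound M.
have [r r0 rx] := dxP (e / C) (divr_gt0 e0 C0); exists r => // s /rx.
rewrite scalemxAl -!mulmxBl => le_e; rewrite (le_trans (CM _))//.
by rewrite -ler_pdivlMl// mulrA [C^-1 * e]mulrC.
Qed.

Lemma is_derive_row (x : R -> 'rV[R]_n) (t : R) dx :
  is_derive t 1 x dx <-> forall i, is_derive t 1 (fun s => x s 0 i) (dx 0 i).
Proof.
split=> [[xd <-] i|dxi].
  have := (derivable_mxP _ _ _).1 xd 0 i => xdi.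
  by apply: DeriveDef => //; rewrite derive_mx// mxE.
have xd : derivable x t 1.
  by apply/derivable_mxP => i j; rewrite ord1; apply: ex_derive.
by apply: DeriveDef => //; rewrite derive_mx//; apply/rowP => i;
  rewrite mxE derive_val.
Qed.

Lemma gram_sqrD v w :
  gram M (v + w) (v + w) = gram M v v + 2 * gram M v w + gram M w w.
Proof. by rewrite !gramE (gramC w v); ring. Qed.

End FormTheory.

Lemma is_derive_gram n m (M : 'M[R]_(n, m)) (x y : R -> 'rV[R]_n) (t : R) dx dy :
  is_derive t 1 x dx -> is_derive t 1 y dy ->
  is_derive t 1 (fun s => gram M (x s) (y s)) (gram M dx (y t) + gram M (x t) dy).
Proof.
move=> /(is_derive_mulmx M)/is_derive_row dxM /(is_derive_mulmx M)/is_derive_row dyM.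
rewrite /gram -big_split/=.
have := @is_derive_sum R R R m (fun k s => (x s *m M) 0 k * (y s *m M) 0 k) t 1
  (fun k => (dx *m M) 0 k * (y t *m M) 0 k + (x t *m M) 0 k * (dy *m M) 0 k).
rewrite (_ : \sum_(i < m) _ = fun s => \sum_k (x s *m M) 0 k * (y s *m M) 0 k).
  apply=> k; apply: is_derive_eq.
  by rewrite /GRing.scale/= addrC mulrC [X in X + _]mulrC mulrC [X in _ + X]mulrC.
by apply/funext => s; rewrite fct_sumE.
Qed.

End Forms.

Lemma is_derive_line (R : realType) (V W : normedModType R) (F : V -> W)
    (z v : V) (t : R) :
  differentiable F (t *: v + z) ->
  is_derive t 1 (fun s => F (s *: v + z)) ('d F (t *: v + z) v).
Proof.
move=> dF.
have dl : is_derive (0 : R) 1 (fun h : R => F (h *: v + (t *: v + z)))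
    ('d F (t *: v + z) v).
  have dv : derivable F (t *: v + z) v by exact: diff_derivable.
  rewrite -deriveE//; apply: DeriveDef; first exact: (derivable1P _ _ _).1 dv.
  rewrite /derive; set g1 := fun h => h^-1 *: _; set g2 := fun h => h^-1 *: _.
  suff -> : g1 = g2 by []; apply/funext => h; rewrite /g1 /g2 /=.
  by rewrite addr0 scale0r add0r [_ *: 1]mulr1.
move/is_derive_distP: dl => dl; apply/is_derive_distP => e e0.
have [r r0 rF] := dl e e0; exists r => // s /[dup] str.
have := rF (s - t); rewrite subr0 scale0r add0r => /(_ str).
by rewrite addrA -scalerDl subrK.
Qed.

(** * Strict differentiability of maps of class C^1 *)

Section StrictDifferentiability.
Context {R : realType} {V : normedModType R} {n : nat}.
Local Notation W := 'rV[R]_n.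
Variables (A : set V) (F : V -> W).
Hypothesis (openA : open A) (C1F : Ck 1 A F).
Variables (I : finType) (b : I -> V) (c : V -> I -> R).
Hypothesis (bc : forall v, v = \sum_i c v i *: b i)
  (c_le : forall v i, `|c v i| <= `|v|).

Lemma linear_basis_bound (L1 L2 : {linear V -> W}) e v :
  (forall i, `|L1 (b i) - L2 (b i)| <= e) ->
  `|L1 v - L2 v| <= e * #|I|%:R * `|v|.
Proof.
move=> Le.
have LE (L : {linear V -> W}) : L v = \sum_i c v i *: L (b i).
  by rewrite [in LHS](bc v) linear_sum; apply: eq_bigr => i _; exact: linearZ.
rewrite (LE L1) (LE L2) -sumrB (le_trans (ler_norm_sum _ _ _))//.
rewrite mulr_natr mulrnAl -sumr_const; apply: ler_sum => i _.
by rewrite -scalerBr normrZ mulrC ler_pM.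
Qed.

(** Continuity of the finitely many directional derivatives along [b] makes the differential
    continuous in operator norm; [e'] absorbs the factor [#|I|] of [linear_basis_bound]. *)
Lemma diff_near z0 e : A z0 -> 0 < e -> exists2 d, 0 < d &
  forall z v, `|z - z0| < d -> A z /\ `|'d F z v - 'd F z0 v| <= e * `|v|.
Proof.
move=> Az0 e0.
pose e' := e / (#|I|%:R + 1).
have n10 : 0 < #|I|%:R + 1 :> R by rewrite ltr_wpDl ?ler0n.
have e'0 : 0 < e' by rewrite divr_gt0.
have [dF cF] := C1F.
have cD v : \forall z \near z0, `|'D_v F z - 'D_v F z0| < e'.
  have /continuous_distP/(_ _ e'0)[d d0 cd] := cF v _ Az0.
  by apply/nbhs_ballP; exists d => //= z; rewrite -ball_normE /ball_/= distrC => /cd.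
have /nbhs_ballP[d /= d0 dP] : \forall z \near z0, A z /\
    forall i, `|'D_(b i) F z - 'D_(b i) F z0| < e'.
  near=> z; split; near: z.
    by move: openA; rewrite openE; apply.
  by apply: filter_forall => i; exact: cD.
exists d => // z v; rewrite distrC => zd.
have [|Az Dz] := dP z; first by rewrite -ball_normE.
split=> //.
apply: (@le_trans _ _ (e' * #|I|%:R * `|v|)).
  apply: linear_basis_bound => i; rewrite -!deriveE; first exact/ltW/Dz.
    exact: dF.
  exact: dF.
rewrite ler_wpM2r// /e' mulrAC ler_pdivrMr// ler_pM2l//; lra.
Unshelve. all: by end_near. Qed.

(** Subtracting the differential at [z0] leaves a map with small differential on a ball, so the mean
    value theorem bounds its increments. Both points vary because the estimate is applied to
    differences of solutions and of equilibria, away from the base point. *)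
Lemma strict_differentiability z0 e : A z0 -> 0 < e -> exists2 d, 0 < d &
  forall z w, `|z - z0| < d -> `|w - z0| < d ->
    A z /\ `|F z - F w - 'd F z0 (z - w)| <= e * `|z - w|.
Proof.
move=> Az0 e0; have [d d0 dF] := diff_near Az0 e0.
exists d => // z w zd wd; split; first exact: (dF z 0 zd).1.
have seg t : 0 <= t -> t <= 1 -> `|t *: (z - w) + w - z0| < d.
  move=> t0 t1; have -> : t *: (z - w) + w - z0 = t *: (z - z0) + (1 - t) *: (w - z0).
    rewrite scalerBl scale1r addrCA -scalerBr.
    by rewrite [- (w - z0)]opprB subrKA -addrA addrC.
  rewrite (le_lt_trans (ler_normD _ _))// !normrZ !ger0_norm ?subr_ge0//.
  have [t0'|t0'] := ltP 0 t; first by nra.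
  have -> : t = 0 by apply/le_anti; rewrite t0 t0'.
  by rewrite mul0r add0r subr0 mul1r.
(* Each coordinate has its own intermediate point, which the sup norm tolerates. *)
apply: row_norm_le => [|i]; first by rewrite mulr_ge0// ltW.
pose g t := F (t *: (z - w) + w) - t *: 'd F z0 (z - w).
pose dg t := 'd F (t *: (z - w) + w) (z - w) - 'd F z0 (z - w).
have gd (t : R) : 0 <= t -> t <= 1 -> is_derive t 1 (fun s => g s 0 i) (dg t 0 i).
  move=> t0 t1; have [+ _] := @is_derive_row R n g t (dg t); apply.
  apply: is_deriveB.
    by apply: is_derive_line; apply: (C1F).1; exact: (dF _ 0 (seg _ t0 t1)).1.
  apply/is_derive_distP => a a0; exists 1 => // s _.
  by rewrite -!scalerBl subrr scale0r normr0 mulr_ge0// ltW.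
have [s /andP[s0 s1]] := MVT_is_derive ler01 gd.
rewrite subr0 mulr1 /g scale0r add0r scale0r subr0 !scale1r subrK => gE.
have -> : (F z - F w - 'd F z0 (z - w)) 0 i = dg s 0 i.
  by rewrite -gE !mxE; ring.
rewrite (le_trans (coord_le_norm _ _))//.
exact: (dF _ _ (seg _ s0 s1)).2.
Qed.

End StrictDifferentiability.

(** The basis of the augmented space: [Some i] stands for a state coordinate, [None] for the
    parameter. *)
Lemma pair_decomposition (R : realType) (n : nat) (v : 'rV[R]_n * R) :
  v = \sum_(o : option 'I_n)
        (if o is Some i then v.1 0 i else v.2) *:
        ((if o is Some i then (delta_mx 0 i, 0) else (0, 1)) : 'rV[R]_n * R).
Proof.
have sumE (I : finType) (g : I -> 'rV[R]_n * R) :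
    \sum_i g i = (\sum_i (g i).1, \sum_i (g i).2).
  elim: (index_enum I) => [|i r IH]; first by rewrite !big_nil.
  by rewrite !big_cons IH [g i]surjective_pairing.
rewrite sumE [v in LHS]surjective_pairing; congr (_, _).
  rewrite (bigD1 None)//= scaler0 add0r.
  rewrite (reindex_omap Some id)/=; last by case.
  under eq_bigl do rewrite eqxx.
  exact: row_sum_delta.
rewrite (bigD1 None)//= [_ *: 1]mulr1 big1 ?addr0// => -[i|//] _.
by rewrite /= scaler0.
Qed.

(** * The vector field near a point of [U] *)

Section System.
Context {R : realType} {n : nat}.
Local Notation V := 'rV[R]_n.
Variables (U : set V) (f : V -> R -> V).
Hypothesis (openU : open U).
Hypothesis f_C2 : @Ck R (V * R)%type V 2 (U `*` [set: R]) (fun p => f p.1 p.2).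
Let F (z : V * R) := f z.1 z.2.

Lemma F_C1 : @Ck R (V * R)%type V 1 (U `*` [set: R]) F.
Proof.
case: f_C2 => dF cF; split=> // v z Az; apply: differentiable_continuous.
exact: (cF v).1.
Qed.

Lemma system_strict p l e : U p -> 0 < e -> exists2 d, 0 < d &
  forall x y s t, `|x - p| < d -> `|y - p| < d -> `|s - l| < d -> `|t - l| < d ->
    U x /\ `|f x s - f y t - 'd F (p, l) (x - y, s - t)| <=
      e * Num.max `|x - y| `|s - t|.
Proof.
move=> Up e0.
have oA : open (U `*` [set: R]).
  rewrite openE => -[x s] [/= Ux _]; exists (U, setT) => /=; first split.
  - by move: openU; rewrite openE; apply.
  - exact: filterT.
  - by move=> [y t] [].
have c_le (v : V * R) (o : option 'I_n) :
    `|if o is Some i then v.1 0 i else v.2| <= `|v|.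
  case: o => [i|]; rewrite prod_normE le_max; last by rewrite lexx orbT.
  by rewrite coord_le_norm.
have Ap : (U `*` [set: R]) (p, l) by split.
have [d d0 dF] := strict_differentiability oA F_C1 (@pair_decomposition R n) c_le Ap e0.
exists d => // x y s t xp yp sl tl.
have [||[Ux _] le_e] := dF (x, s) (y, t).
- by rewrite prod_normE/= gt_max xp.
- by rewrite prod_normE/= gt_max yp.
by split=> //; rewrite prod_normE in le_e.
Qed.

Lemma system_lipschitz p l : U p -> exists d L, [/\ 0 < d, 0 < L &
  forall x y s t, `|x - p| < d -> `|y - p| < d -> `|s - l| < d -> `|t - l| < d ->
    U x /\ `|f x s - f y t| <= L * (`|x - y| + `|s - t|)].
Proof.
move=> Up; have [d d0 dF] := system_strict l Up ltr01.
have cdF : continuous ('d F (p, l)).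
  by apply: diff_continuous; apply: F_C1.1.
have [k k0 dFk] := linear_lipschitz cdF.
exists d, (k + 1); split=> //; first by rewrite addr_gt0.
move=> x y s t xp yp sl tl; have [Ux le1] := dF x y s t xp yp sl tl; split=> //.
have := dFk (x - y, s - t); rewrite prod_normE/= => le2.
have le3 : Num.max `|x - y| `|s - t| <= `|x - y| + `|s - t|.
  by rewrite ge_max lerDl lerDr !normr_ge0.
rewrite -(subrK ('d F (p, l) (x - y, s - t)) (f x s - f y t)).
rewrite (le_trans (ler_normD _ _))//; nra.
Qed.

(** Strict differentiability of the joint map, at two points with a common parameter. The Jacobian
    is taken at [l] alone, yet the estimate holds for all [s] near [l], as a drifting parameter
    requires. *)
Lemma system_jacobian p l e : U p -> 0 < e -> exists2 d, 0 < d &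
  forall x y s, `|x - p| < d -> `|y - p| < d -> `|s - l| < d ->
    U x /\ `|f x s - f y s - (x - y) *m 'J (f^~ l) p| <= e * `|x - y|.
Proof.
move=> Up e0; have [d d0 dF] := system_strict l Up e0.
exists d => // x y s xp yp sl; have [Ux] := dF x y s s xp yp sl sl; split=> //.
move: b; rewrite subrr normr0 (max_idPl (normr_ge0 _)).
suff -> : (x - y) *m 'J (f^~ l) p = 'd F (p, l) (x - y, 0) by [].
rewrite /jacobian mul_rV_lin1.
have dFpl : differentiable F (p, l) by apply: F_C1.1.
have dg : is_diff p (fun x : V => (x, l)) (fun h => (h, 0)) by exact: is_diff_pair.
have -> : f^~ l = F \o (fun x => (x, l)) by [].
by rewrite diff_comp//= diff_val.
Qed.

End System.

(** * The Lyapunov form of a matrix with spectrum in the left half-plane *)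

Section Hurwitz.
Context {R : realType}.
Local Notation C := R[i].
Local Notation Re := (@complex.Re R).
Local Notation Im := (@complex.Im R).

Lemma finite_lower_bound (I : finType) (g : I -> R) :
  (forall i, 0 < g i) -> exists2 c, 0 < c & forall i, c <= g i.
Proof.
move=> g0; exists (\big[Order.min/1]_i g i) => [|i]; last exact: bigmin_le.
by elim/big_ind: _ => // x y x0 y0; rewrite lt_min x0.
Qed.

Lemma finite_upper_bound (I : finType) (g : I -> R) :
  exists2 K, 1 <= K & forall i, g i <= K.
Proof.
exists (\big[Order.max/1]_i g i) => [|i]; last exact: le_bigmax.
exact: bigmax_ge_id.
Qed.

(** The squared modulus, with values in [R] so that sums of it can be compared. *)
Definition sqc (z : C) : R := Re z ^+ 2 + Im z ^+ 2.

Lemma sqc_ge0 z : 0 <= sqc z.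
Proof. by rewrite addr_ge0 ?sqr_ge0. Qed.

(** The real part of z times the conjugate of w: the inner product of the real plane. *)
Definition rdot (z w : C) : R := Re z * Re w + Im z * Im w.

Lemma rdotDl z z' w : rdot (z + z') w = rdot z w + rdot z' w.
Proof. by case: z => a b; case: z' => c d; rewrite /rdot /=; ring. Qed.

Lemma rdot_suml (I : finType) (g : I -> C) w :
  rdot (\sum_i g i) w = \sum_i rdot (g i) w.
Proof.
apply: (big_morph (rdot^~ w)) => [z z'|]; first exact: rdotDl.
by rewrite /rdot /= !mul0r addr0.
Qed.

Lemma rdot_diag z t : rdot (z * t) z = Re t * sqc z.
Proof. by case: z => a b; case: t => c d; rewrite /rdot /sqc /=; ring. Qed.

Lemma rdot_offdiag z t w eta : `|Re t| <= eta -> `|Im t| <= eta ->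
  rdot (z * t) w <= eta * (sqc z + sqc w).
Proof.
case: z => a b; case: t => p q; case: w => c d; rewrite /rdot /sqc /=.
move=> /ler_normlP[p1 p2] /ler_normlP[q1 q2].
have e0 : 0 <= eta by lra.
rewrite [leLHS](_ : _ = p * (a * c + b * d) - q * (b * c - a * d)); last by ring.
have aux (r x y x' y' : R) : - r <= eta -> r <= eta ->
    r * (x * x' + y * y') <= eta * (x ^+ 2 + y ^+ 2 + x' ^+ 2 + y' ^+ 2) / 2.
  move=> r1 r2.
  have k1 : 0 <= eta - r by lra.
  have k2 : 0 <= eta + r by lra.
  have := mulr_ge0 k1 (addr_ge0 (sqr_ge0 (x + x')) (sqr_ge0 (y + y'))).
  have := mulr_ge0 k2 (addr_ge0 (sqr_ge0 (x - x')) (sqr_ge0 (y - y'))).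
  by rewrite !expr2; lra.
have := aux p a b c d p1 p2.
have := aux (- q) b (- a) c d; rewrite opprK => /(_ q2 q1).
rewrite sqrrN mulNr; lra.
Qed.

(** The matrix is lower triangular. For k < i the entry is multiplied by K^-(i - k) <= 1/K, and [K]
    exceeds all entries divided by [eta]; for i < k the entry is 0. *)
Lemma trig_scaling n (T : 'M[C]_n) (eta : R) : is_trig_mx T -> 0 < eta ->
  exists K : R, K != 0 /\ forall i k : 'I_n, i != k ->
    let t := (K%:C)%C ^- i * T i k * (K%:C)%C ^+ k in
    `|Re t| <= eta /\ `|Im t| <= eta.
Proof.
move=> /is_trig_mxP trT eta0.
have [K K1 TK] := finite_upper_bound (fun ij : 'I_n * 'I_n =>
  (`|Re (T ij.1 ij.2)| + `|Im (T ij.1 ij.2)|) / eta).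
have K0 : 0 < K by lra.
exists K; split=> [|i k ik]; first by rewrite gt_eqF.
have [lt_ik|ge_ik] := ltnP i k.
  by rewrite /= trT// mulr0 mul0r /= !normr0 ltW.
have {ik ge_ik}lt_ki : (k < i)%N by rewrite ltn_neqAle ge_ik andbT eq_sym.
have -> : (K%:C)%C ^- i * T i k * (K%:C)%C ^+ k = T i k * ((K ^- (i - k))%:C)%C.
  rewrite mulrAC mulrC; congr (_ * _).
  have KC : (K%:C)%C != 0 :> C by rewrite (_ : 0 = (0%:C)%C)// eq_complex /= eqxx andbT gt_eqF.
  rewrite rmorphV ?unitfE ?expf_neq0 ?gt_eqF// rmorphXn/=.
  rewrite -{1}(subnK (ltnW lt_ki)) exprD invfM mulrAC -mulrA divff ?mulr1//.
  exact: expf_neq0.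
have := TK (i, k); rewrite /= ler_pdivrMr// => {}TK.
have Kik : 0 < K ^- (i - k) <= K^-1.
  rewrite invr_gt0 exprn_gt0//= lef_pV2 ?posrE ?exprn_gt0//.
  by rewrite -{1}(expr1 K) ler_weXn2l// subn_gt0.
move: TK Kik; case: (T i k) => a b /=; move: (K ^- (i - k)) => r TK /andP[r0 rK].
have rK1 : r * K <= 1 by rewrite -ler_pdivlMr// div1r.
have := normr_ge0 a; have := normr_ge0 b => b0 a0.
have rKe : r * (`|a| + `|b|) <= eta by nra.
rewrite !mulr0 subr0 add0r !normrM (gtr0_norm r0); split; nra.
Qed.

(* Schur form, followed by conjugation with diag(K^i), which makes the strictly
   triangular part negligible for large K. *)
Lemma hurwitz_conjugate n (A : 'M[C]_n) :
  (forall mu, eigenvalue A mu -> Re mu < 0) ->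
  exists (Q Qi T : 'M[C]_n) (c : R), [/\ Q *m Qi = 1%:M, A *m Q = Q *m T, 0 < c &
    forall z : 'rV[C]_n, \sum_k rdot ((z *m T) 0 k) (z 0 k) <=
      - c * \sum_k sqc (z 0 k)].
Proof.
(* The Schur form is taken in positive size; in size 0 all sums vanish. *)
case: n A => [|n] A Aneg.
  exists 1%:M, 1%:M, 0, 1; split=> //; rewrite ?mulmx1 ?mulmx0 //.
    by apply/matrixP => -[].
  by move=> z; rewrite !big_ord0 mulr0.
have [P /unitarymx_unit Pu] := Schur A (ltn0Sn n).
rewrite /similar_to /= conjumx//; set T := P *m A *m invmx P => trT.
have TP : T *m P = P *m A by rewrite mulmxKV.
have Tneg k : 0 < - Re (T k k).
  rewrite oppr_gt0; apply: Aneg.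
  have : eigenvalue T (T k k).
    rewrite eigenvalue_root_char char_poly_trig// /root horner_prod.
    by rewrite (bigD1 k)//= !hornerE subrr mul0r.
  move=> /eigenvalueP[v vT v0]; apply/eigenvalueP; exists (v *m P).
    by rewrite -mulmxA -TP mulmxA vT scalemxAl.
  by rewrite -(mulmxK Pu v) in v0; apply: contra_neq v0 => ->; rewrite mul0mx.
have [c c0 Tc] := finite_lower_bound Tneg.
(* The off-diagonal terms add up to at most 2 (n + 1) [eta] times the sum of the [sqc], that is, to
   half of the decay [c] of the diagonal. *)
pose eta := c / (4 * n.+1%:R).
have n0 : 0 < 4 * n.+1%:R :> R by rewrite mulr_gt0 ?ltr0n.
have eta0 : 0 < eta by rewrite divr_gt0.
have [K [K0 TK]] := trig_scaling trT eta0.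
pose k := (K%:C)%C.
have k0 : k != 0 :> C by rewrite (_ : 0 = (0%:C)%C)// eq_complex /= eqxx andbT.
pose D := diag_mx (\row_(i < n.+1) k ^+ i).
pose Di := diag_mx (\row_(i < n.+1) k ^- i).
have DDi : D *m Di = 1%:M.
  rewrite mulmx_diag; apply/matrixP => i j; rewrite !mxE; congr (_ *+ _).
  by rewrite divff// expf_neq0.
exists (invmx P *m D), (Di *m P), (Di *m T *m D), (c / 2); split.
- by rewrite mulmxA -(mulmxA _ D) DDi mulmx1 mulVmx.
- rewrite /T !mulmxA -(mulmxA (invmx P) D) DDi mulmx1.
  by rewrite mulVmx// mul1mx.
- by rewrite divr_gt0.
move=> z; set T' := Di *m T *m D.
have T'E i j : T' i j = k ^- i * T i j * k ^+ j.
  by rewrite /T' mul_mx_diag mul_diag_mx !mxE.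
have S0 : 0 <= \sum_j sqc (z 0 j) by apply: sumr_ge0 => j _; exact: sqc_ge0.
apply: (@le_trans _ _ (\sum_j \sum_i ((if i == j then - c * sqc (z 0 j) else 0) +
    eta * (sqc (z 0 i) + sqc (z 0 j))))).
  apply: ler_sum => j _; rewrite mxE rdot_suml; apply: ler_sum => i _.
  rewrite T'E; have [->|ij] := eqVneq i j.
    rewrite rdot_diag mulrAC mulVf ?expf_neq0// mul1r.
    have := sqc_ge0 (z 0 j); have := Tc j => ? ?.
    by rewrite -[leLHS]addr0 lerD//; nra.
  by rewrite add0r; have [? ?] := TK _ _ ij; exact: rdot_offdiag.
pose S := \sum_j sqc (z 0 j).
have E j : \sum_i ((if i == j then - c * sqc (z 0 j) else 0) +
    eta * (sqc (z 0 i) + sqc (z 0 j))) =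
    - c * sqc (z 0 j) + eta * (S + n.+1%:R * sqc (z 0 j)).
  rewrite big_split/= -big_mkcond/= big_pred1_eq; congr (_ + _).
  by rewrite -mulr_sumr big_split/= sumr_const card_ord mulr_natl.
rewrite (eq_bigr _ (fun j _ => E j)) big_split/= -!mulr_sumr -/S.
rewrite big_split/= sumr_const card_ord -mulr_sumr -/S.
have -> : eta * (S *+ n.+1 + n.+1%:R * S) = c / 2 * S.
  by rewrite -mulr_natl /eta; field; rewrite nat1r pnatr_eq0.
lra.
Qed.

(** Write the complex row v Q as real parts followed by imaginary parts: [gram M v v] is then the
    sum of the squared moduli of its entries. The minus sign in [N] comes from the real part of the
    product of [Q] and [Qi]. *)
Lemma hurwitz_gram n (J : 'M[R]_n) :
  (forall mu : C, eigenvalue (map_mx (real_complex R) J) mu -> Re mu < 0) ->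
  exists (m : nat) (M : 'M[R]_(n, m)) (N : 'M[R]_(m, n)) (c : R),
    [/\ M *m N = 1%:M, 0 < c &
      forall v, gram M (v *m J) v <= - c * gram M v v].
Proof.
move=> /hurwitz_conjugate[Q [Qi [T [c [QQi AQ c0 Tneg]]]]].
have ReM (z w : C) : Re (z * w) = Re z * Re w - Im z * Im w.
  by case: z => a b; case: w.
have ReS (I : finType) (g : I -> C) : Re (\sum_i g i) = \sum_i Re (g i).
  by apply: (big_morph Re) => // -[a b] [a' b'].
have ImS (I : finType) (g : I -> C) : Im (\sum_i g i) = \sum_i Im (g i).
  by apply: (big_morph Im) => // -[a b] [a' b'].
pose M := row_mx (map_mx Re Q) (map_mx Im Q).
pose N := col_mx (map_mx Re Qi) (- map_mx Im Qi).
have MlE (v : 'rV[R]_n) k :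
    (v *m map_mx Re Q) 0 k = Re ((map_mx (real_complex R) v *m Q) 0 k).
  rewrite !mxE ReS; apply: eq_bigr => i _; rewrite !mxE.
  by case: (Q i k) => a b /=; rewrite mul0r subr0.
have MrE (v : 'rV[R]_n) k :
    (v *m map_mx Im Q) 0 k = Im ((map_mx (real_complex R) v *m Q) 0 k).
  rewrite !mxE ImS; apply: eq_bigr => i _; rewrite !mxE.
  by case: (Q i k) => a b /=; rewrite mul0r addr0.
have gramE v w : gram M v w = \sum_k
    rdot ((map_mx (real_complex R) v *m Q) 0 k) ((map_mx (real_complex R) w *m Q) 0 k).
  rewrite /gram big_split_ord /= -big_split; apply: eq_bigr => k _ /=.
  by rewrite /M !mul_mx_row !row_mxEl !row_mxEr !MlE !MrE.
exists (n + n)%N, M, N, c; split=> // [|v].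
  rewrite /M /N mul_row_col; apply/matrixP => i j.
  have := congr1 (fun A : 'M[C]_n => Re (A i j)) QQi.
  rewrite !mxE ReS => QE.
  have -> : (i == j)%:R = Re (i == j)%:R by case: (i == j).
  rewrite -QE -big_split; apply: eq_bigr => k _ /=.
  by rewrite !mxE ReM mulrN.
rewrite !gramE map_mxM -mulmxA AQ mulmxA.
apply: le_trans (Tneg _) _; rewrite le_eqVlt; apply/orP; left; apply/eqP.
by congr (_ * _); apply: eq_bigr => k _; rewrite /rdot /sqc !expr2.
Qed.

End Hurwitz.

(** * Trajectories near attracting equilibria *)

Lemma small_positive (R : realType) (s : seq R) :
  all (fun x => 0 < x) s -> exists2 d, 0 < d & all (fun x => d < x) s.
Proof.
elim: s => [_|x s IH /= /andP[x0 /IH[d d0 ds]]]; first by exists 1.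
exists (Num.min d x / 2).
  by rewrite divr_gt0 // lt_min d0.
have [m1 m2] : Num.min d x <= d /\ Num.min d x <= x by rewrite !ge_min !lexx orbT.
have m0 : 0 < Num.min d x by rewrite lt_min d0.
apply/andP; split; first by lra.
by apply: sub_all ds => y dy; lra.
Qed.

Lemma normr_lt_sqr (R : realType) (V : normedModType R) (v : V) (r : R) :
  0 < r -> `|v| ^+ 2 < r ^+ 2 -> `|v| < r.
Proof. by move=> r0; rewrite ltr_pXn2r// ?nnegrE// ltW. Qed.

(** The sup norm of a trajectory may fail to be differentiable; away from equilibria the Euclidean
    form [gram 1%:M] replaces it in the barrier arguments. *)
Lemma euclidean_bounds (R : realType) (n : nat) : exists2 C : R, 0 < C &
  (forall v : 'rV[R]_n, `|v| ^+ 2 <= C * gram 1%:M v v) /\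
  (forall v w : 'rV[R]_n, `|gram 1%:M v w| <= C * (`|v| * `|w|)).
Proof.
have [C1 C10 H1] := gram_lower_bound (mulmx1 (1%:M : 'M[R]_n)).
have [C2 C20 H2] := gram_bound (1%:M : 'M[R]_n).
exists (C1 + C2); first exact: addr_gt0.
split=> [v|v w].
  by rewrite (le_trans (H1 v))// ler_wpM2r ?gram_ge0// lerDl ltW.
by rewrite (le_trans (H2 v w))// ler_wpM2r ?mulr_ge0// lerDr ltW.
Qed.

Section Dynamics.
Context {R : realType} {n : nat}.
Local Notation V := 'rV[R]_n.
Variables (U : set V) (f : V -> R -> V).
Hypothesis (openU : open U).
Hypothesis f_C2 : @Ck R (V * R)%type V 2 (U `*` [set: R]) (fun p => f p.1 p.2).

(** A one-sided Lipschitz condition with negative constant [- c], in the form given by [M], between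
    any two states at the same parameter. A single [C] serves for both norm comparisons and for the
    Lipschitz bound. *)
Definition contracting (p : V) (l : R) m (M : 'M[R]_(n, m)) (C c d : R) : Prop :=
  [/\ [/\ 0 < C, 0 < c & 0 < d],
      forall v, `|v| ^+ 2 <= C * gram M v v,
      forall v w, `|gram M v w| <= C * (`|v| * `|w|) &
      forall x y s t,
        `|x - p| < d -> `|y - p| < d -> `|s - l| < d -> `|t - l| < d ->
        [/\ U x, gram M (f x s - f y s) (x - y) <= - c * gram M (x - y) (x - y) &
            `|f x s - f y t| <= C * (`|x - y| + `|s - t|)]].

Lemma attracting_contracting p l : attracting_equilibrium U f p l ->
  exists m (M : 'M[R]_(n, m)) C c d, contracting p l M C c d.
Proof.
case=> Up fp0 /hurwitz_gram[m [M [N [c [MN c0 Mc]]]]].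
have [C1 C10 H1] := gram_lower_bound MN; have [C2 C20 H2] := gram_bound M.
have [d1 [L [d10 L0 H3]]] := system_lipschitz openU f_C2 l Up.
(* With this error the nonlinear remainder costs at most half of the linear decay: C2 bounds the
   form by the norm, C1 the squared norm by the form. *)
have e0 : 0 < c / (2 * C2 * C1) by rewrite divr_gt0// !mulr_gt0.
have [d2 d20 H4] := system_jacobian openU f_C2 l Up e0.
have [d d0 /and3P[dd1 dd2 _]] := @small_positive _ [:: d1; d2] ltac:(by rewrite /= d10 d20).
exists m, M, (C1 + C2 + L), (c / 2), d; split.
- by rewrite !addr_gt0 ?divr_gt0.
- by move=> v; rewrite (le_trans (H1 v))// ler_wpM2r ?gram_ge0//; lra.
- by move=> v w; rewrite (le_trans (H2 v w))// ler_wpM2r ?mulr_ge0//; lra.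
move=> x y s t xp yp sl tl.
have up1 u : u < d -> u < d1 by move/lt_trans; apply.
have up2 u : u < d -> u < d2 by move/lt_trans; apply.
have [Ux H3'] := H3 x y s t (up1 _ xp) (up1 _ yp) (up1 _ sl) (up1 _ tl).
have [_ H4'] := H4 x y s (up2 _ xp) (up2 _ yp) (up2 _ sl).
split=> //; last first.
  by rewrite (le_trans H3')// ler_wpM2r ?addr_ge0//; lra.
set h := x - y in H4' *; set A := h *m _ in H4'.
rewrite -(subrK A (f x s - f y s)) gramDl.
have := ler_norm (gram M (f x s - f y s - A) h).
have := H2 (f x s - f y s - A) h; have := Mc h; have := H1 h; rewrite -/A expr2.
move=> k1 k2 k3 k4.
have k5 : `|f x s - f y s - A| * `|h| <= c / (2 * C2 * C1) * `|h| * `|h|.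
  by rewrite ler_wpM2r.
have k6 : C2 * (`|f x s - f y s - A| * `|h|) <= c / 2 * gram M h h.
  apply: (le_trans (ler_wpM2l (ltW C20) k5)).
  have -> : C2 * (c / (2 * C2 * C1) * `|h| * `|h|) = c / 2 / C1 * (`|h| * `|h|).
    by field; rewrite !gt_eqF.
  rewrite -mulrA ler_pM2l ?divr_gt0// mulrC ler_pdivrMr// mulrC; lra.
lra.
Qed.

Definition solution (x : R -> V) (lam : R -> R) (a b : R) : Prop :=
  forall t : R, a <= t -> t <= b -> U (x t) /\ is_derive t 1 x (f (x t) (lam t)).

Lemma is_derive_gram_sub m (M : 'M[R]_(n, m)) (x y : R -> V) (t : R) dx dy :
  is_derive t 1 x dx -> is_derive t 1 y dy ->
  is_derive t 1 (fun s => gram M (x s - y s) (x s - y s))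
    (2 * gram M (dx - dy) (x t - y t)).
Proof.
move=> xd yd; have xyd : is_derive t 1 (fun s => x s - y s) (dx - dy).
  exact: is_deriveB.
apply: (is_derive_eq (is_derive_gram M xyd xyd)).
by rewrite [X in _ + X]gramC mulr2n mulrDl mul1r.
Qed.

Lemma is_derive_gram_cst m (M : 'M[R]_(n, m)) (x : R -> V) (p : V) (t : R) dx :
  is_derive t 1 x dx ->
  is_derive t 1 (fun s => gram M (x s - p) (x s - p)) (2 * gram M dx (x t - p)).
Proof.
move=> xd; have := is_derive_gram_sub M xd (is_derive_cst p t 1).
by rewrite subr0.
Qed.

(** Split [f x s] as ([f x s - f p s]) + [f p s]. The first part contracts at rate 2 c; the second
    is O(|s - l|) because [f p l = 0], and Young's inequality spends one c on it. *)
Lemma lyapunov_decay p l m (M : 'M[R]_(n, m)) C c d x s :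
  contracting p l M C c d -> f p l = 0 -> `|x - p| < d -> `|s - l| < d ->
  2 * gram M (f x s) (x - p) <=
    - c * gram M (x - p) (x - p) + C ^+ 3 / c * `|s - l| ^+ 2.
Proof.
case=> [[C0 c0 d0] H1 H2 H3] fp0 xp sl.
have z0 (W : normedModType R) (q : W) : `|q - q| < d by rewrite subrr normr0.
have [_ contr _] := H3 x p s l xp (z0 _ _) sl (z0 _ _).
have [_ _ lip] := H3 p p s l (z0 _ _) (z0 _ _) sl (z0 _ _).
rewrite fp0 subr0 subrr normr0 add0r in lip.
rewrite -(subrK (f p s) (f x s)) gramDl mulrDr.
have := gram_young M (f p s) (x - p) (_ : 0 < c^-1).
rewrite invr_gt0 invrK => /(_ c0) young.
have quad : gram M (f p s) (f p s) <= C ^+ 3 * `|s - l| ^+ 2.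
  apply: (le_trans (ler_norm _)); apply: (le_trans (H2 _ _)).
  have : `|f p s| * `|f p s| <= (C * `|s - l|) * (C * `|s - l|) by exact: ler_pM.
  rewrite -(ler_pM2l C0) => /le_trans; apply.
  by rewrite le_eqVlt; apply/orP; left; apply/eqP; ring.
rewrite -(ler_pM2l (_ : 0 < c^-1)) ?invr_gt0// in quad.
have -> : C ^+ 3 / c * `|s - l| ^+ 2 = c^-1 * (C ^+ 3 * `|s - l| ^+ 2) by ring.
lra.
Qed.

Lemma trap p l e : attracting_equilibrium U f p l -> 0 < e ->
  exists2 d, 0 < d & forall x lam a b, solution x lam a b ->
    (forall t, a <= t -> t <= b -> `|lam t - l| < d) -> `|x a - p| < d ->
    forall t, a <= t -> t <= b -> `|x t - p| < e.
Proof.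
move=> attp e0; have [_ fp0 _] := attp.
have [m [M [C [c [d0 cM]]]]] := attracting_contracting attp.
have [[C0 c0 d00] H1 H2 H3] := cM.
have [r r0 /and3P[re rd _]] := @small_positive _ [:: e; d0] ltac:(by rewrite /= e0 d00).
(* The sublevel [rho] of the form lies in the ball of radius [r]. The choice of [d] puts the initial
   point inside it and keeps the forcing C^3 / c d^2 below the decay [c * rho], so the level can
   only be crossed inwards. *)
pose rho := r ^+ 2 / (2 * C).
have rho0 : 0 < rho by rewrite divr_gt0 ?exprn_gt0// mulr_gt0.
have Crho : C * rho < r ^+ 2.
  have -> : C * rho = r ^+ 2 / 2 by rewrite /rho; field; rewrite gt_eqF.
  by have := exprn_gt0 2 r0; lra.
have q1 : 0 < rho / C by exact: divr_gt0.
have C3 : 0 < C ^+ 3 / c by rewrite divr_gt0 ?exprn_gt0.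
have q2 : 0 < c * rho / (C ^+ 3 / c) by rewrite divr_gt0// mulr_gt0.
have [d dp /and5P[d1 d2 d3 d4 _]] := @small_positive _
  [:: 1; d0; rho / C; c * rho / (C ^+ 3 / c)] ltac:(by rewrite /= ltr01 d00 q1 q2).
have dd : d * d <= d by rewrite ger_pMl// ltW.
exists d => // x lam a b sol lamd xa.
pose W t := gram M (x t - p) (x t - p).
have small v : gram M v v <= rho -> `|v| < r.
  move=> Wr; apply: normr_lt_sqr => //; apply: le_lt_trans (H1 v) _.
  by apply: le_lt_trans Crho; rewrite ler_pM2l.
suff Wrho t : a <= t -> t <= b -> W t < rho.
  by move=> t at_ tb; apply: lt_trans re; apply: small; exact/ltW/Wrho.
move: t; apply: barrier_derive.
- by move=> t at_ tb; apply: is_derive_gram_cst; exact: (sol t at_ tb).2.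
- apply: (le_lt_trans (ler_norm _)); apply: (le_lt_trans (H2 _ _)).
  have : `|x a - p| * `|x a - p| <= d * d by apply: ler_pM => //; exact: ltW.
  move: d3; rewrite ltr_pdivlMr// => d3 h.
  by apply: le_lt_trans d3; rewrite mulrC ler_wpM2r ?(ltW C0)//; lra.
move=> t at_ tb; rewrite /W => Wt; have tl := lamd t at_ tb.
have xp : `|x t - p| < d0 by apply: lt_trans rd; apply: small; rewrite Wt.
apply: le_lt_trans (lyapunov_decay cM fp0 xp (lt_trans tl d2)) _.
rewrite Wt mulNr addrC subr_lt0.
rewrite ltr_pdivlMr// in d4; apply: le_lt_trans d4.
rewrite mulrC ler_pM2r// (le_trans _ dd)// expr2.
by apply: ler_pM => //; exact: ltW.
Qed.

End Dynamics.

Lemma is_derive_addr (R : realType) (W : normedModType R) (g : R -> W) (t a : R) d :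
  is_derive (t + a) 1 g d -> is_derive t 1 (fun s => g (s + a)) d.
Proof.
move=> /is_derive_distP gd; apply/is_derive_distP => e e0.
have [r r0 rg] := gd e e0; exists r => // s st.
by have := rg (s + a); rewrite opprD addrACA subrr addr0; apply.
Qed.

(** * Solutions over bounded times *)

Section FiniteTime.
Context {R : realType} {n : nat}.
Local Notation V := 'rV[R]_n.
Variables (U : set V) (f : V -> R -> V).
Hypothesis (openU : open U).
Hypothesis f_C2 : @Ck R (V * R)%type V 2 (U `*` [set: R]) (fun p => f p.1 p.2).
Local Notation solution := (solution U f).

Lemma solution_addr x lam a u v : solution x lam (u + a) (v + a) ->
  solution (fun t => x (t + a)) (fun t => lam (t + a)) u v.
Proof.
move=> sol t ut tv; have [|| Ux dx] := sol (t + a); rewrite ?lerD2r//.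
by split=> //; exact: is_derive_addr.
Qed.

Lemma solution_sub x lam a b u v : a <= u -> v <= b ->
  solution x lam a b -> solution x lam u v.
Proof.
by move=> au vb sol t ut tv; apply: sol; [exact: le_trans ut | exact: le_trans vb].
Qed.

(** During a jump the parameter may take any value of the segment, so local bounds are merged along
    it: the smaller radius and the sum of the bounds. *)
Lemma velocity_bound p lm lp : U p -> lm <= lp ->
  exists d K, [/\ 0 < d, 0 < K &
    forall x s, `|x - p| < d -> lm <= s -> s <= lp -> `|f x s| <= K].
Proof.
move=> Up lmp; pose B a b := exists d K, [/\ 0 < d, 0 < K &
  forall x s, `|x - p| < d -> a <= s -> s <= b -> `|f x s| <= K].
apply: (@chain_segment _ B lm lp) => //.
  move=> a b c _ _ _ _ [d1 [K1 [d10 K10 H1]]] [d2 [K2 [d20 K20 H2]]].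
  exists (Num.min d1 d2), (K1 + K2); split; first by rewrite lt_min d10.
    exact: addr_gt0.
  move=> x s; rewrite lt_min => /andP[xd1 xd2] as_ sc.
  have [sb|/ltW bs] := leP s b.
    by rewrite (le_trans (H1 x s xd1 as_ sb))// lerDl ltW.
  by rewrite (le_trans (H2 x s xd2 bs sc))// lerDr ltW.
move=> s0 _ _; have [d [L [d0 L0 H]]] := system_lipschitz openU f_C2 s0 Up.
exists d => // a b _ _ _ /ltr_normlP[a1 a2] /ltr_normlP[b1 b2].
exists d, (`|f p s0| + 2 * L * d); split=> //.
  by rewrite ltr_wpDl// !mulr_gt0.
move=> x s xp as_ sb.
have ss : `|s - s0| < d by rewrite ltr_norml; lra.
have [||_] := H x p s s0 xp _ ss; rewrite ?subrr ?normr0// => le1.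
rewrite -(subrK (f p s0) (f x s)) (le_trans (ler_normD _ _))// addrC lerD2l.
apply: (le_trans le1).
have -> : 2 * L * d = L * (d + d) by ring.
by rewrite ler_pM2l// lerD// ltW.
Qed.

(** Near [p] the speed is bounded whatever the parameter does, so a short time means a small
    displacement. This makes a fast parameter jump harmless. *)
Lemma short_time p lm lp e : U p -> lm <= lp -> 0 < e ->
  exists2 d, 0 < d & forall x lam a b, solution x lam a b ->
    (forall t, a <= t -> t <= b -> lm <= lam t <= lp) ->
    `|x a - p| < d -> a <= b -> b - a < d -> `|x b - p| < e.
Proof.
move=> Up lmp e0; have [d0 [K [d00 K0 fK]]] := velocity_bound Up lmp.
have [C C0 [H1 H2]] := euclidean_bounds R n.
have [r r0 /and3P[re rd _]] := @small_positive _ [:: e; d0] ltac:(by rewrite /= e0 d00).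
(* [2 * C * K * r] bounds the derivative of the squared distance inside the ball of radius [r]. The
   initial value and the elapsed growth each get a budget [q], and the sublevel [2 * q] lies in that
   ball. *)
pose k := 2 * C * K * r + 1.
have k0 : 0 < k by rewrite ltr_wpDl// ltW// !mulr_gt0.
have q1 : 0 < r ^+ 2 / (4 * C) by rewrite divr_gt0 ?exprn_gt0 ?mulr_gt0.
pose q := r ^+ 2 / (4 * C).
have q2 : 0 < q / k by exact: divr_gt0.
have q3 : 0 < q / C by exact: divr_gt0.
have [d dp /and4P[d1 d2 d3 _]] := @small_positive _ [:: 1; q / k; q / C]
  ltac:(by rewrite /= ltr01 q2 q3).
have dd : d * d <= d by rewrite ger_pMl// ltW.
rewrite ltr_pdivlMr// in d2; rewrite ltr_pdivlMr// in d3.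
exists d => // x lam a b sol lamP xa ab bad.
pose W t := gram 1%:M (x t - p) (x t - p) - (t - a) * k.
have small (v : V) : gram 1%:M v v <= 2 * q -> `|v| < r.
  move=> vq; apply: normr_lt_sqr => //; apply: le_lt_trans (H1 v) _.
  apply: (@le_lt_trans _ _ (C * (2 * q))); first by rewrite ler_pM2l.
  have -> : C * (2 * q) = r ^+ 2 / 2 by rewrite /q; field; rewrite gt_eqF.
  by have := exprn_gt0 2 r0; lra.
have tak t : a <= t -> t <= b -> (t - a) * k < q.
  move=> at_ tb; apply: le_lt_trans d2; rewrite ler_pM2r//; lra.
suff Wq t : a <= t -> t <= b -> W t < q.
  apply: lt_trans re; apply: small.
  have := Wq b ab (lexx b); have := tak b ab (lexx b); rewrite /W; lra.
move: t; apply: (@barrier_derive _ _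
    (fun t => 2 * gram 1%:M (f (x t) (lam t)) (x t - p) - k)).
- move=> t at_ tb; have [_ dx] := sol t at_ tb.
  apply: is_deriveB; first exact: is_derive_gram_cst.
  by apply: is_derive_eq; rewrite /GRing.scale/=; ring.
- rewrite /W subrr mul0r subr0.
  apply: (le_lt_trans (ler_norm _)); apply: (le_lt_trans (H2 _ _)).
  have : `|x a - p| * `|x a - p| <= d * d by apply: ler_pM => //; exact: ltW.
  move=> h; apply: le_lt_trans d3; rewrite mulrC ler_wpM2r ?(ltW C0)//; lra.
move=> t at_ tb Wt; have [Ux _] := sol t at_ tb.
have xr : `|x t - p| < r by apply: small; have := tak t at_ tb; move: Wt; rewrite /W; lra.
have /andP[l1 l2] := lamP t at_ tb.
have fb := fK (x t) (lam t) (lt_trans xr rd) l1 l2.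
have := le_trans (ler_norm _) (H2 (f (x t) (lam t)) (x t - p)).
have : `|f (x t) (lam t)| * `|x t - p| <= K * r by apply: ler_pM => //; exact: ltW.
rewrite -(ler_pM2l C0) /k; lra.
Qed.

(** Continuous dependence on the initial state and on the parameter along a reference solution.
    Composition reduces it to short segments, where an exponentially damped squared distance is a
    barrier. *)
Lemma follow phi l T e : solution phi (fun=> l) 0 T -> 0 <= T -> 0 < e ->
  exists2 d, 0 < d & forall x lam, solution x lam 0 T ->
    (forall t, 0 <= t -> t <= T -> `|lam t - l| < d) ->
    `|x 0 - phi 0| < d -> `|x T - phi T| < e.
Proof.
move=> solphi T0.
have [C C0 [H1 H2]] := euclidean_bounds R n.
pose B a b := forall e, 0 < e ->
  exists2 d, 0 < d & forall x lam, solution x lam a b ->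
    (forall t, a <= t -> t <= b -> `|lam t - l| < d) ->
    `|x a - phi a| < d -> `|x b - phi b| < e.
move: e; apply: (@chain_segment _ B 0 T) => //.
  move=> a b c _ ab bc _ Hab Hbc e /Hbc[d2 d20 {}Hbc].
  have [d1 d10 {}Hab] := Hab _ d20.
  exists (Num.min d1 d2) => [|x lam sol lamd xa]; first by rewrite lt_min d10.
  apply: (Hbc x lam) => [|t bt tc|]; first exact: (solution_sub ab (lexx c) sol).
    by have := lamd t (le_trans ab bt) tc; rewrite lt_min => /andP[].
  apply: (Hab x lam) => [|t at_ tb|]; first exact: (solution_sub (lexx a) bc sol).
    by have := lamd t at_ (le_trans tb bc); rewrite lt_min => /andP[].
  by move: xa; rewrite lt_min => /andP[].
move=> s0 s00 s0T; have [Uphi dphi] := solphi s0 s00 s0T.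
have [d0 [L [d00 L0 H]]] := system_lipschitz openU f_C2 l Uphi.
have d02 : 0 < d0 / 2 by rewrite divr_gt0.
have /continuous_distP/(_ _ d02)[rphi rphi0 phic] := is_derive_continuous dphi.
exists (Num.min rphi 1); first by rewrite lt_min rphi0 ltr01.
move=> a b a0 ab bT; rewrite !lt_min => /andP[ar /ltr_normlP[a1 a2]].
move=> /andP[br /ltr_normlP[b1 b2]] e e0.
have [r r0 /and3P[re rd _]] := @small_positive _ [:: e; d0 / 2] ltac:(by rewrite /= e0 d02).
(* At the critical level [(v + d) * v] is at most [(2 * C + 1) * S t] (step [g3]), so [K * S t]
   exceeds the growth of [S]. The factor [expR (- (2 * K))] in [rho] is the worst damping, the
   segment having length below 2. *)
pose K := 2 * C * L * (2 * C + 1) + 1.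
have K0 : 0 < K.
  by rewrite ltr_wpDl// ltW// !mulr_gt0// addr_gt0 ?mulr_gt0.
pose rho := r ^+ 2 / (2 * C) * expR (- (2 * K)).
have rho0 : 0 < rho by rewrite mulr_gt0 ?expR_gt0// divr_gt0 ?exprn_gt0 ?mulr_gt0.
have q1 : 0 < rho / C by rewrite divr_gt0.
have [d dp /and5P[d1 d2 d3 d4 _]] := @small_positive _ [:: 1; d0; rho; rho / C]
  ltac:(by rewrite /= ltr01 d00 rho0 q1).
have dd : d * d <= d by rewrite ger_pMl// ltW.
rewrite ltr_pdivlMr// in d4.
exists d => // x lam sol lamd xa.
pose S t := gram 1%:M (x t - phi t) (x t - phi t).
pose E t := expR (- (K * (t - a))).
have EK t : a <= t -> t <= b -> expR (- (2 * K)) <= E t.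
  move=> at_ tb; rewrite ler_expR lerN2.
  by rewrite mulrC ler_pM2r//; lra.
have small t : a <= t -> t <= b -> E t * S t <= rho -> `|x t - phi t| < r.
  move=> at_ tb ES; apply: normr_lt_sqr => //; apply: le_lt_trans (H1 _) _.
  have S0 : 0 <= S t by exact: gram_ge0.
  have : expR (- (2 * K)) * S t <= rho.
    by apply: le_trans ES; rewrite ler_wpM2r// EK.
  rewrite /rho mulrC ler_pM2r ?expR_gt0// => h.
  apply: (@le_lt_trans _ _ (C * (r ^+ 2 / (2 * C)))); first by rewrite ler_pM2l.
  have -> : C * (r ^+ 2 / (2 * C)) = r ^+ 2 / 2 by field; rewrite gt_eqF.
  by have := exprn_gt0 2 r0; lra.
pose G t := f (x t) (lam t) - f (phi t) l.
suff Wq t : a <= t -> t <= b -> E t * S t < rho.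
  apply: lt_trans re; apply: small => //.
  exact/ltW/Wq.
move: t; apply: (@barrier_derive _ _ (fun t =>
    E t * (2 * gram 1%:M (G t) (x t - phi t) - K * S t))).
- move=> t at_ tb; have [_ dx] := sol t at_ tb.
  have [_ dph] := solphi t (le_trans a0 at_) (le_trans tb bT).
  have dS : is_derive t 1 S (2 * gram 1%:M (G t) (x t - phi t)).
    exact: is_derive_gram_sub.
  have dE : is_derive t 1 E (- K * E t).
    by rewrite /E; apply: is_derive_eq; rewrite /GRing.scale/=; ring.
  apply: is_derive_eq; rewrite /GRing.scale/=; ring.
- rewrite /E subrr mulr0 oppr0 expR0 mul1r.
  apply: (le_lt_trans (ler_norm _)); apply: (le_lt_trans (H2 _ _)).
  have : `|x a - phi a| * `|x a - phi a| <= d * d by apply: ler_pM => //; exact: ltW.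
  move=> h; apply: le_lt_trans d4; rewrite mulrC ler_wpM2r ?(ltW C0)//; lra.
move=> t at_ tb ESt; rewrite pmulr_rlt0 ?expR_gt0// subr_lt0.
have xr := small t at_ tb (ltac:(by rewrite ESt)).
have tr : `|t - s0| < rphi.
  by move: ar br; rewrite !ltr_norml; lra.
have pr := phic t tr.
have xp : `|x t - phi s0| < d0.
  rewrite -(subrKA (phi t)) (le_lt_trans (ler_normD _ _))//; lra.
have pp : `|phi t - phi s0| < d0 by clear - pr d00; lra.
have lt_ := lamd t at_ tb.
have [||_ lip] := H (x t) (phi t) (lam t) l xp pp; rewrite ?subrr ?normr0//.
  exact: lt_trans d2.
have g1 := le_trans (ler_norm _) (H2 (G t) (x t - phi t)).
set v := `|x t - phi t| in lip g1 *.
have v0 : 0 <= v by exact: normr_ge0.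
have g2 : `|G t| * v <= L * (v + d) * v.
  by rewrite ler_wpM2r//; apply: (le_trans lip); rewrite ler_pM2l// lerD2l ltW.
have S1 : v ^+ 2 <= C * S t := H1 _.
(* The damping factor is at most 1. Hence, at the critical level, the squared parameter error is
   dominated by [S t] too. *)
have S2 : rho <= S t.
  rewrite -ESt -[leRHS]mul1r ler_wpM2r ?gram_ge0//.
  by rewrite /E -expR0 ler_expR oppr_le0 mulr_ge0 ?(ltW K0)// subr_ge0.
have g3 : (v + d) * v <= 2 * C * S t + S t.
  have : 0 <= (v - d) ^+ 2 := sqr_ge0 _.
  have := mulr_ge0 v0 v0; have := lt_le_trans rho0 S2; rewrite !expr2 in S1 *.
  clear - S1 S2 dd d3; lra.
have g4 : C * (`|G t| * v) <= C * (L * (2 * C * S t + S t)).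
  rewrite ler_pM2l//; apply: (le_trans g2); rewrite -mulrA ler_pM2l//.
have -> : K * S t = 2 * (C * (L * (2 * C * S t + S t))) + S t by rewrite /K; ring.
have := lt_le_trans rho0 S2; lra.
Qed.

End FiniteTime.

Section Infinity.
Context {R : realType} {W : normedModType R}.
Implicit Types (x : R -> W) (q : W).

Lemma cvg_pinfty_distP x q : x t @[t --> +oo] --> q <->
  forall e, 0 < e -> exists T, forall t, T <= t -> `|x t - q| < e.
Proof.
split=> [/cvgrPdist_lt xq e /xq[T [_ HT]]|xq].
  by exists (T + 1) => t tT; rewrite distrC; apply: HT; rewrite /=; lra.
apply/cvgrPdist_lt => e /xq[T HT]; exists T; split; first exact: num_real.
by move=> t Tt; rewrite distrC; exact/HT/ltW.
Qed.

Lemma cvg_ninfty_distP x q : x t @[t --> -oo] --> q <->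
  forall e, 0 < e -> exists T, forall t, t <= T -> `|x t - q| < e.
Proof.
split=> [/cvgrPdist_lt xq e /xq[T [_ HT]]|xq].
  by exists (T - 1) => t tT; rewrite distrC; apply: HT; rewrite /=; lra.
apply/cvgrPdist_lt => e /xq[T HT]; exists T; split; first exact: num_real.
by move=> t Tt; rewrite distrC; exact/HT/ltW.
Qed.

Lemma eq_of_dist (p q : W) : (forall e, 0 < e -> `|p - q| < e) -> p = q.
Proof.
move=> pq; apply/eqP; rewrite -subr_eq0 -normr_eq0 eq_le normr_ge0 andbT.
by rewrite leNgt; apply/negP => /pq; rewrite ltxx.
Qed.

End Infinity.

Lemma Ck1_locally_lipschitz (R : realType) (g : R -> R) (s : R) :
  @Ck R R R 1 setT g -> exists d L, [/\ 0 < d, 0 < L &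
    forall u v, `|u - s| < d -> `|v - s| < d -> `|g u - g v| <= L * `|u - v|].
Proof.
case=> dg cg.
have gd (t : R) : is_derive t 1 g ('D_1 g t).
  by apply: derivableP; apply: diff_derivable; exact: dg.
have /continuous_distP/(_ _ ltr01)[d d0 dD] := cg 1 s I.
exists d, (`|'D_1 g s| + 1); split; [by [] | by rewrite ltr_wpDl | ].
have main u v : u <= v -> `|u - s| < d -> `|v - s| < d ->
    `|g u - g v| <= (`|'D_1 g s| + 1) * `|u - v|.
  move=> uv us vs; have [c /andP[uc cv]] := MVT_is_derive uv (fun t _ _ => gd t).
  rewrite distrC [`|u - v|]distrC => ->; rewrite normrM ler_wpM2r//.
  have /dD cD : `|c - s| < d by move: us vs; rewrite !ltr_norml; lra.
  rewrite -(subrK ('D_1 g s) ('D_1 g c)) (le_trans (ler_normD _ _))// addrC.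
  by rewrite lerD2l ltW.
move=> u v us vs; have [uv|/ltW vu] := leP u v; first exact: main.
by rewrite distrC [`|u - v|]distrC; exact: main.
Qed.

Lemma gram_continuous (R : realType) (n m : nat) (M : 'M[R]_(n, m)) :
  continuous (fun v => gram M v v).
Proof.
move=> w; apply/continuous_distP => e e0; have [C C0 H] := gram_bound M.
have k0 : 0 < C * (1 + 2 * `|w|) by rewrite mulr_gt0// ltr_wpDr// mulr_ge0.
have q0 : 0 < e / (C * (1 + 2 * `|w|)) by rewrite divr_gt0.
have [d d0 /and3P[d1 d2 _]] := @small_positive _ [:: 1; e / (C * (1 + 2 * `|w|))]
  ltac:(by rewrite /= ltr01 q0).
rewrite ltr_pdivlMr// in d2.
exists d => // v vw.
have -> : gram M v v - gram M w w = gram M (v - w) ((v - w) + 2 *: w).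
  by rewrite !gramE (gramC _ w v); ring.
apply: le_lt_trans (H _ _) _; apply: le_lt_trans d2.
rewrite mulrCA; apply: ler_pM => //; first by rewrite mulr_ge0// ltW.
  exact: ltW.
rewrite ler_pM2l// (le_trans (ler_normD _ _))// normrZ ger0_norm//.
by rewrite lerD2r; apply/ltW/(lt_trans vw).
Qed.

(** * Attraction under small changes of the parameter *)

Section Asymptotics.
Context {R : realType} {n : nat}.
Local Notation V := 'rV[R]_n.
Variables (U : set V) (f : V -> R -> V).
Hypothesis (openU : open U).
Hypothesis f_C2 : @Ck R (V * R)%type V 2 (U `*` [set: R]) (fun p => f p.1 p.2).
Local Notation solution := (solution U f).
Local Notation attracting := (attracting_equilibrium U f).

Lemma basin_solution q l p : basin U f q l p -> exists phi : R -> V,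
  [/\ forall b, solution phi (fun=> l) 0 b, phi 0 = p & phi t @[t --> +oo] --> q].
Proof.
case=> a [phi [a0 tr phi0 phiq]]; exists phi; split=> // b t t0 _.
by apply: tr; rewrite ?ltry// lte_fin (lt_le_trans a0).
Qed.

(** Wait until the reference solution in the basin is within e / 2 of [q], then apply [follow] after
    a shift of time. [d] and [T] do not depend on the starting time [a]. *)
Lemma reach q l p e : basin U f q l p -> 0 < e ->
  exists d T, [/\ 0 < d, 0 <= T & forall x lam a, solution x lam a (a + T) ->
    (forall t, a <= t -> t <= a + T -> `|lam t - l| < d) -> `|x a - p| < d ->
    `|x (a + T) - q| < e].
Proof.
move=> /basin_solution[phi [solphi <- phiq]] e0.
have e2 : 0 < e / 2 by rewrite divr_gt0.
have [T0 HT0] := (cvg_pinfty_distP phi q).1 phiq _ e2.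
pose T := Num.max 0 T0.
have T_ge0 : 0 <= T by rewrite le_max lexx.
have TT0 : T0 <= T by rewrite le_max lexx orbT.
have [d d0 H] := follow openU f_C2 (solphi T) T_ge0 e2.
exists d, T; split=> // x lam a sol lamd xa.
have := H (fun t => x (t + a)) (fun t => lam (t + a)); rewrite add0r => /(_ _ _ xa).
rewrite (addrC T a) => xT.
have {}xT : `|x (a + T) - phi T| < e / 2.
  apply: xT; first by apply: solution_addr; rewrite add0r addrC.
  by move=> t t0 tT; apply: lamd; rewrite ?lerDr// addrC lerD2l.
have h := HT0 T TT0; rewrite -(subrKA (phi T)).
by apply: le_lt_trans (ler_normD _ _) _; lra.
Qed.

Lemma settle q l p e : attracting q l -> basin U f q l p -> 0 < e ->
  exists d T, [/\ 0 < d, 0 <= T & forall x lam a, (forall b, solution x lam a b) ->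
    (forall t, a <= t -> `|lam t - l| < d) -> `|x a - p| < d ->
    forall t, a + T <= t -> `|x t - q| < e].
Proof.
move=> attq bas e0; have [d1 d10 H1] := trap openU f_C2 attq e0.
have [d2 [T [d20 T0 H2]]] := reach bas d10.
exists (Num.min d1 d2), T; split=> //; first by rewrite lt_min d10.
move=> x lam a sol lamd xa t tT.
have lam12 s : a <= s -> `|lam s - l| < d1 /\ `|lam s - l| < d2.
  by move/lamd; rewrite lt_min => /andP[].
apply: (H1 x lam (a + T) t) => //.
- by apply: solution_sub (sol t); rewrite ?lerDl.
- by move=> s sT _; apply: (lam12 _ _).1; apply: le_trans sT; rewrite lerDl.
apply: (H2 x lam a) => // [s as_ _|]; first exact: (lam12 _ _).2.
by move: xa; rewrite lt_min => /andP[].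
Qed.

(** A solution from [p] at the constant parameter [l'] tends to [q'], yet by [settle] it ends up
    within e / 2 of [q]. *)
Lemma settle_limit q l p e : attracting q l -> basin U f q l p -> 0 < e ->
  exists2 d, 0 < d & forall q' l', `|l' - l| < d -> basin U f q' l' p ->
    `|q' - q| < e.
Proof.
move=> attq bas e0; have e2 : 0 < e / 2 by rewrite divr_gt0.
have [d [T [d0 T0 H]]] := settle attq bas e2.
exists d => // q' l' ll' /basin_solution[x [sol xp xq']].
have [T' HT'] := (cvg_pinfty_distP x q').1 xq' _ e2.
pose t := Num.max (0 + T) T'.
have tT : 0 + T <= t by rewrite le_max lexx.
have tT' : T' <= t by rewrite le_max lexx orbT.
have h1 : `|x t - q| < e / 2.
  by apply: (H x (fun=> l') 0) => //; rewrite xp subrr normr0.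
have h2 := HT' t tT'; rewrite distrC in h2.
by rewrite -(subrKA (x t)) (le_lt_trans (ler_normD _ _))//; lra.
Qed.

(** [basin] only provides some solution tending to the equilibrium; [settle_limit] at [l' = l]
    excludes two limits from the same initial state. *)
Lemma basin_unique q q' l p : attracting q l -> basin U f q l p ->
  basin U f q' l p -> q' = q.
Proof.
move=> attq bas bas'; apply: eq_of_dist => e e0.
have [d d0 H] := settle_limit attq bas e0.
by apply: (H q' l); rewrite ?subrr ?normr0.
Qed.

End Asymptotics.

(** * Curves of attracting equilibria and solutions that follow them *)

Section StablePaths.
Context {R : realType} {n : nat}.
Local Notation V := 'rV[R]_n.
Variables (U : set V) (f : V -> R -> V).
Hypothesis (openU : open U).
Hypothesis f_C2 : @Ck R (V * R)%type V 2 (U `*` [set: R]) (fun p => f p.1 p.2).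
Local Notation solution := (solution U f).
Local Notation attracting := (attracting_equilibrium U f).
Variable L : R -> R.
Hypothesis L_C1 : @Ck R R R 1 setT L.

(** Compare [Y s] and [Y t] at the common parameter [L s]: contraction bounds their distance by the
    size of [f (Y t) (L s)], which is O(|L s - L t|) since [f (Y t) (L t) = 0]. This is a
    quantitative form of the implicit function theorem. *)
Lemma path_lipschitz (Y : R -> V) p l m (M : 'M[R]_(n, m)) C c d K s t :
  contracting U f p l M C c d -> (forall s, attracting (Y s) (L s)) ->
  `|Y s - p| < d -> `|Y t - p| < d -> `|L s - l| < d -> `|L t - l| < d ->
  `|L s - L t| <= K * `|s - t| ->
  `|Y s - Y t| <= C / c * (C * (C * K)) * `|s - t|.
Proof.
case=> [[C0 c0 d0] H1 H2 H3] attY Ys Yt Ls Lt HLst.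
have [_ fYs _] := attY s; have [_ fYt _] := attY t.
have [_ contr _] := H3 _ _ _ _ Ys Yt Ls Ls.
have [_ _] := H3 _ _ _ _ Yt Yt Ls Lt.
rewrite subrr normr0 add0r fYt subr0 => lip.
rewrite fYs sub0r gramNl in contr.
set D := Y s - Y t in contr *.
have g1 := le_trans (ler_norm _) (H2 (f (Y t) (L s)) D).
have g2 : `|f (Y t) (L s)| <= C * (K * `|s - t|).
  by apply: le_trans lip _; rewrite ler_pM2l.
have [D0|D0] := eqVneq D 0.
  have := le_trans (normr_ge0 _) g2; rewrite pmulr_rge0// => g3.
  rewrite D0 normr0.
  have -> : C / c * (C * (C * K)) * `|s - t| = C / c * C * C * (K * `|s - t|) by ring.
  by apply: mulr_ge0 => //; apply: ltW; rewrite !mulr_gt0// invr_gt0.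
have Dp : 0 < `|D| by rewrite normr_gt0.
have g3 : c * gram M D D <= C * (C * (K * `|s - t|) * `|D|).
  apply: (@le_trans _ _ (C * (`|f (Y t) (L s)| * `|D|))); first lra.
  by rewrite ler_pM2l// ler_pM2r.
rewrite -(ler_pM2r Dp) -expr2; apply: (le_trans (H1 D)).
rewrite -[gram M D D](mulKf (lt0r_neq0 c0)).
have -> : C / c * (C * (C * K)) * `|s - t| * `|D| =
    C * (c^-1 * (C * (C * (K * `|s - t|) * `|D|))) by ring.
by rewrite ler_pM2l// ler_pM2l// invr_gt0.
Qed.

(** The radius [d / 2] leaves room for a solution within [d / 2] of the path to remain in the
    contracting region. *)
Lemma path_near (Y : R -> V) s0 m (M : 'M[R]_(n, m)) C c d :
  contracting U f (Y s0) (L s0) M C c d ->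
  continuous Y -> (forall s, attracting (Y s) (L s)) ->
  exists r K, [/\ 0 < r, 0 < K & forall s t, `|s - s0| < r -> `|t - s0| < r ->
    [/\ `|Y s - Y s0| < d / 2, `|L s - L s0| < d &
        `|Y s - Y t| <= K * `|s - t|]].
Proof.
move=> cM cY attY; have [[C0 c0 d0] _ _ _] := cM.
have d20 : 0 < d / 2 by rewrite divr_gt0.
have /continuous_distP/(_ _ d20)[r1 r10 HY] := cY s0.
have [r2 [K [r20 K0 HL]]] := Ck1_locally_lipschitz s0 L_C1.
have dK : 0 < d / K by rewrite divr_gt0.
have [r r0 /and4P[rr1 rr2 rK _]] := @small_positive _ [:: r1; r2; d / K]
  ltac:(by rewrite /= r10 r20 dK).
have HL0 s : `|s - s0| < r -> `|L s - L s0| < d.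
  move=> sr; apply: (@le_lt_trans _ _ (K * `|s - s0|)).
    by apply: HL; rewrite ?subrr ?normr0// (lt_trans sr).
  by rewrite mulrC -ltr_pdivlMr// (lt_trans sr).
exists r, (C / c * (C * (C * K))); split=> //.
  by rewrite mulr_gt0 ?divr_gt0// !mulr_gt0.
move=> s t sr tr.
have Ys := HY s (lt_trans sr rr1); have Yt := HY t (lt_trans tr rr1).
split=> //; first exact: HL0.
apply: (path_lipschitz cM attY) => //; try exact: HL0; try lra.
by apply: HL; [exact: lt_trans rr2 | exact: lt_trans rr2].
Qed.

(* A fixed level set of the Lyapunov form around the moving point Y (k t + c) is a
   barrier: contraction beats the drift of Y, which is O(k). *)
Lemma track_local (Y : R -> V) p0 l m (M : 'M[R]_(n, m)) C c d0 K e :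
  contracting U f p0 l M C c d0 -> continuous Y ->
  (forall s, attracting (Y s) (L s)) -> 0 < K -> 0 < e ->
  exists2 d, 0 < d & forall a b,
    (forall s t, a <= s <= b -> a <= t <= b ->
      [/\ `|Y s - p0| < d0 / 2, `|L s - l| < d0 & `|Y s - Y t| <= K * `|s - t|]) ->
    forall k c x t0 t1, 0 < k -> k < d -> k * t0 + c = a -> k * t1 + c = b ->
      t0 <= t1 -> solution x (fun t => L (k * t + c)) t0 t1 ->
      `|x t0 - Y a| < d -> `|x t1 - Y b| < e.
Proof.
move=> cM cY attY K0 e0; have [[C0 c0 d00] H1 H2 H3] := cM.
have d02 : 0 < d0 / 2 by rewrite divr_gt0.
have [q q0 /and4P[q1 qe qd _]] := @small_positive _ [:: 1; e; d0 / 2]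
  ltac:(by rewrite /= ltr01 e0 d02).
pose rho := q ^+ 2 / (2 * C).
have rho0 : 0 < rho by rewrite divr_gt0 ?exprn_gt0 ?mulr_gt0.
have qC : 0 < rho / C by rewrite divr_gt0.
have CK0 : 0 < 4 * C * K by rewrite !mulr_gt0.
have crho : 0 < c * rho by exact: mulr_gt0.
have qK : 0 < c * rho / (4 * C * K) by exact: divr_gt0.
(* Going back by a time [h] gains 2 c rho h in the form. Half of it pays the linearisation error,
   the other half the drift term 4 C K k h, which is why k < c rho / (4 C K). *)
have [d dp /and4P[d1 d2 d3 _]] := @small_positive _ [:: 1; rho / C; c * rho / (4 * C * K)]
  ltac:(by rewrite /= ltr01 qC qK).
have dd : d * d <= d by rewrite ger_pMl// ltW.
rewrite ltr_pdivlMr// in d2; rewrite ltr_pdivlMr// in d3.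
exists d => // a b HY k k' x t0 t1 k0 kd t0a t1b t01 sol xa.
pose sg t := k * t + k'.
have sgr t : t0 <= t -> t <= t1 -> a <= sg t <= b.
  move=> t0t tt1; have k1 : k * t0 <= k * t by rewrite ler_pM2l.
  have k2 : k * t <= k * t1 by rewrite ler_pM2l.
  by rewrite /sg -t0a -t1b !lerD2r k1.
pose W t := gram M (x t - Y (sg t)) (x t - Y (sg t)).
have small v : gram M v v <= rho -> `|v| < q.
  move=> vq; apply: normr_lt_sqr => //; apply: le_lt_trans (H1 v) _.
  apply: (@le_lt_trans _ _ (C * rho)); first by rewrite ler_pM2l.
  have -> : C * rho = q ^+ 2 / 2 by rewrite /rho; field; rewrite gt_eqF.
  by have := exprn_gt0 2 q0; lra.
suff Wq t : t0 <= t -> t <= t1 -> W t < rho.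
  by rewrite -t1b; apply: lt_trans qe; apply/small/ltW/Wq.
move: t; apply: barrier.
- move=> t t0t tt1; apply: (@continuous_comp _ _ _ _ (fun v => gram M v v)); last first.
    exact: gram_continuous.
  apply: continuousB; first exact: is_derive_continuous (sol t t0t tt1).2.
  apply: (@continuous_comp _ _ _ sg Y); last exact: cY.
  apply: continuousD; last exact: cst_continuous.
  by apply: continuousM; [exact: cst_continuous | exact: cvg_id].
- rewrite /W /sg t0a; apply: (le_lt_trans (ler_norm _)).
  apply: (le_lt_trans (H2 _ _)).
  have : `|x t0 - Y a| * `|x t0 - Y a| <= d * d by apply: ler_pM => //; exact: ltW.
  move=> h; apply: le_lt_trans d2; rewrite mulrC ler_wpM2r ?(ltW C0)//; lra.
move=> t t0t tt1 Wt s t0s st.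
have [_ dx] := sol t (ltW t0t) tt1.
(* The path is merely Lipschitz, so its point is frozen at time [t]: the form around [p] can be
   differentiated, and the displacement of [Y] enters afterwards as the cross term of [v] and
   [w]. *)
pose p := Y (sg t).
pose D u := gram M (x u - p) (x u - p).
have dD : is_derive t 1 D (2 * gram M (f (x t) (L (sg t))) (x t - p)).
  exact: is_derive_gram_cst.
have xpq : `|x t - p| < q by apply: small; rewrite -/(W t) Wt.
have [pd Ld _] := HY _ _ (sgr t (ltW t0t) tt1) (sgr t (ltW t0t) tt1).
have xd : `|x t - p0| < d0.
  by rewrite -(subrKA p) (le_lt_trans (ler_normD _ _))//; lra.
have [_ contr _] := H3 (x t) p (L (sg t)) (L (sg t)) xd (ltac:(lra)) Ld Ld.
have [_ fp _] := attY (sg t).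
rewrite fp subr0 -/(W t) Wt in contr.
have [r1 r10 HD] := (is_derive_distP D t _).1 dD _ crho.
have /continuous_distP/(_ _ ltr01)[r2 r20 Hx] := is_derive_continuous dx.
have ts0 : 0 < t - s by rewrite subr_gt0.
have [h h0 /and4P[hr1 hr2 hs _]] := @small_positive _ [:: r1; r2; t - s]
  ltac:(by rewrite /= r10 r20 ts0).
exists (t - h); first by rewrite ltrBrDr -ltrBrDl hs ltrBlDr ltrDl.
have hth : `|t - h - t| = h by rewrite addrAC subrr sub0r normrN gtr0_norm.
have := HD (t - h); rewrite hth => /(_ hr1).
have := Hx (t - h); rewrite hth => /(_ hr2) xth.
have -> : D t = rho by exact: Wt.
move=> /ler_normlP[+ _]; rewrite /GRing.scale/= => HDh.
have xw : `|x (t - h) - p| <= 2.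
  rewrite -(subrKA (x t)) (le_trans (ler_normD _ _))// -[2]/(1 + 1).
  by rewrite lerD// ltW// (lt_trans xpq).
have t0h : t0 <= t - h by rewrite (le_trans t0s)// lerBrDr -lerBrDl ltW.
have th1 : t - h <= t1 by rewrite (le_trans _ tt1)// lerBlDr lerDl ltW.
have [_ _] := HY _ _ (sgr _ (ltW t0t) tt1) (sgr _ t0h th1).
have -> : `|sg t - sg (t - h)| = k * h.
  rewrite /sg (_ : _ - _ = k * h); last by ring.
  by rewrite gtr0_norm// mulr_gt0.
rewrite -/p => HYh.
rewrite /W.
have -> : x (t - h) - Y (sg (t - h)) = (x (t - h) - p) + (p - Y (sg (t - h))).
  by rewrite subrKA.
set v := x (t - h) - p in xw *; set w := p - _ in HYh *.
rewrite gram_sqrD.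
have vw := ler_norm (- gram M v w); rewrite normrN in vw.
have vw' : `|gram M v w| <= C * (2 * (K * (k * h))).
  by apply: (le_trans (H2 _ _)); rewrite ler_pM2l//; apply: ler_pM.
have ww := gram_ge0 M w.
have Dvv : D (t - h) = gram M v v by [].
have kk : C * (2 * (K * (k * h))) * 2 <= c * rho * h.
  have -> : C * (2 * (K * (k * h))) * 2 = k * (4 * C * K) * h by ring.
  rewrite ler_pM2r// (le_trans _ (ltW d3))// ler_pM2r ?mulr_gt0//.
  exact: ltW.
rewrite Dvv in HDh.
have hg : h * (2 * gram M (f (x t) (L (sg t))) (x t - p)) <= h * (2 * (- c * rho)).
  by rewrite ler_pM2l// ler_pM2l.
lra.
Qed.

(** The affine clock [k * t + c] is kept with free [k] and [c], so that an intermediate point of the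
    path corresponds to a time on the same clock and the statements compose. *)
Lemma track (Y : R -> V) lo hi e :
  continuous Y -> (forall s, attracting (Y s) (L s)) -> lo <= hi -> 0 < e ->
  exists2 d, 0 < d & forall k c x t0 t1, 0 < k -> k < d ->
    k * t0 + c = lo -> k * t1 + c = hi ->
    solution x (fun t => L (k * t + c)) t0 t1 ->
    `|x t0 - Y lo| < d -> `|x t1 - Y hi| < e.
Proof.
move=> cY attY lohi.
pose B a b := forall e, 0 < e ->
  exists2 d, 0 < d & forall k c x t0 t1, 0 < k -> k < d ->
    k * t0 + c = a -> k * t1 + c = b ->
    solution x (fun t => L (k * t + c)) t0 t1 ->
    `|x t0 - Y a| < d -> `|x t1 - Y b| < e.
move: e; apply: (@chain_segment _ B lo hi) => //.
  move=> a b c _ ab bc _ Hab Hbc e /Hbc[d2 d20 {}Hbc].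
  have [d1 d10 {}Hab] := Hab _ d20.
  exists (Num.min d1 d2); first by rewrite lt_min d10.
  move=> k k' x t0 t1 k0; rewrite lt_min => /andP[kd1 kd2] ta tc sol.
  rewrite lt_min => /andP[xa _].
  pose t := (b - k') / k.
  have tb : k * t + k' = b by rewrite /t; field; rewrite gt_eqF.
  have t0t : t0 <= t by rewrite -(ler_pM2l k0); lra.
  have tt1 : t <= t1 by rewrite -(ler_pM2l k0); lra.
  apply: (Hbc k k' x t) => //; first exact: (solution_sub t0t (lexx t1) sol).
  apply: (Hab k k' x t0) => //; exact: (solution_sub (lexx t0) tt1 sol).
move=> s0 _ _.
have [m [M [C [c [d0 cM]]]]] := attracting_contracting openU f_C2 (attY s0).
have [r [K [r0 K0 HY]]] := path_near cM cY attY.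
exists r => // a b _ ab _ ar br e e0.
have [d dp Hd] := track_local cM cY attY K0 e0.
exists d => // k k' x t0 t1 k0 kd t0a t1b sol xa.
apply: (Hd a b _ k k' x t0 t1) => //; last by rewrite -(ler_pM2l k0); lra.
move=> s t /andP[as_ sb] /andP[at_ tb].
by apply: HY; move: ar br; rewrite !ltr_norml; lra.
Qed.

(** Agreement is closed by continuity and open by contraction: two zeros of the field at the same
    parameter inside a contracting region coincide. *)
Lemma stable_path_eq (X Y : R -> V) lo hi :
  continuous X -> (forall s, attracting (X s) (L s)) ->
  continuous Y -> (forall s, attracting (Y s) (L s)) ->
  lo <= hi -> X lo = Y lo -> X hi = Y hi.
Proof.
move=> cX attX cY attY lohi.
pose B a b := X a = Y a -> X b = Y b.
apply: (@chain_segment _ B lo hi) => // [x y z _ _ _ _ xy yz /xy/yz//|s0 _ _].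
(* If the paths differ at [s0] they differ nearby, and the local implication is vacuous. *)
have [XY|XY] := eqVneq (X s0) (Y s0); last first.
  have e0 : 0 < `|X s0 - Y s0| / 2 by rewrite divr_gt0 ?normr_gt0 ?subr_eq0.
  have /continuous_distP/(_ _ e0)[r1 r10 HX] := cX s0.
  have /continuous_distP/(_ _ e0)[r2 r20 HY] := cY s0.
  exists (Num.min r1 r2); first by rewrite lt_min r10.
  move=> x y _ _ _; rewrite lt_min => /andP[/HX h1 /HY h2] _ XYx.
  rewrite -XYx distrC in h2; rewrite distrC in h1.
  exfalso; have := ler_normD (X s0 - X x) (X x - Y s0).
  by rewrite subrKA; rewrite distrC in h2; lra.
have [m [M [C [c [d cM]]]]] := attracting_contracting openU f_C2 (attX s0).
have cM' := cM; rewrite XY in cM'.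
have [rX [KX [rX0 KX0 HX]]] := path_near cM cX attX.
have [rY [KY [rY0 KY0 HY]]] := path_near cM' cY attY.
have [[C0 c0 d0] H1 H2 H3] := cM.
exists (Num.min rX rY); first by rewrite lt_min rX0.
move=> x s _ _ _ _; rewrite lt_min => /andP[sX sY] _.
have [Xs Ls _] := HX _ _ sX sX; have [Ys _ _] := HY _ _ sY sY.
rewrite -XY in Ys.
have [_ contr _] := H3 (X s) (Y s) (L s) (L s) (ltac:(lra)) (ltac:(lra)) Ls Ls.
have [_ fX _] := attX s; have [_ fY _] := attY s.
rewrite fX fY subrr gram0l in contr.
have g0 : gram M (X s - Y s) (X s - Y s) <= 0.
  by rewrite -(pmulr_rle0 _ c0); lra.
have : `|X s - Y s| ^+ 2 <= 0.
  by apply: (le_trans (H1 _)); rewrite pmulr_rle0.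
rewrite real_exprn_even_le0 ?num_real//= normr_eq0 subr_eq0.
by move/eqP.
Qed.

End StablePaths.

(** * The pullback attractor *)

Lemma geometric_small (R : realType) (A q e : R) : 0 <= q -> q < 1 -> 0 < e ->
  exists k : nat, A * q ^+ k < e.
Proof.
move=> q0 q1 e0; have qn : `|q| < 1 by rewrite ger0_norm.
have A0 : 0 < e / (`|A| + 1) by rewrite divr_gt0// ltr_wpDl.
have /cvgrPdist_lt/(_ _ A0)[k _ Hk] := cvg_expr qn.
exists k; have := Hk k (leqnn k); rewrite /= sub0r normrN.
rewrite (ger0_norm (exprn_ge0 _ q0)) ltr_pdivlMr ?ltr_wpDl// => h.
apply: le_lt_trans h; rewrite mulrC ler_wpM2l ?exprn_ge0//.
by have := ler_norm A; lra.
Qed.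

(** With [e k] the tail of the geometric series, [u k - e k] is nondecreasing and [u k + e k]
    nonincreasing; the nested intervals give the limit together with the rate. *)
Lemma geometric_limit (R : realType) (u : nat -> R) (A q : R) :
  0 <= q -> q < 1 -> (forall k, `|u k.+1 - u k| <= A * q ^+ k) ->
  exists l, forall k, `|u k - l| <= A / (1 - q) * q ^+ k.
Proof.
move=> q0 q1 uA; pose e k := A / (1 - q) * q ^+ k.
have q10 : 0 < 1 - q by lra.
have eS k : e k = e k.+1 + A * q ^+ k.
  by rewrite /e exprS; field; rewrite gt_eqF.
have e0 k : 0 <= e k.
  have A0 : 0 <= A by have := le_trans (normr_ge0 _) (uA 0); rewrite expr0 mulr1.
  by rewrite /e mulr_ge0 ?exprn_ge0// divr_ge0// ltW.
have up k m : u k - e k <= u (k + m)%N - e (k + m)%N.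
  elim: m => [|m IH]; first by rewrite addn0.
  apply: (le_trans IH); rewrite addnS.
  by have /ler_normlP[] := uA (k + m)%N; have := eS (k + m)%N; lra.
have dn k m : u (k + m)%N + e (k + m)%N <= u k + e k.
  elim: m => [|m IH]; first by rewrite addn0.
  apply: le_trans IH; rewrite addnS.
  by have /ler_normlP[] := uA (k + m)%N; have := eS (k + m)%N; lra.
pose P := [set u k + e k | k in [set: nat]].
have lowP j k : u j - e j <= u k + e k.
  have := up j k; have := dn k j; rewrite addnC; have := e0 (j + k)%N; lra.
exists (inf P) => k; rewrite -/(e k) ler_norml.
have h1 : inf P <= u k + e k.
  by apply: ge_inf; [exists (u 0 - e 0) => _ [j _ <-] | exists k].
have h2 : u k - e k <= inf P.
  by apply: lb_le_inf => [|_ [j _ <-]//]; exists (u 0 + e 0), 0%N.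
lra.
Qed.

Lemma row_geometric_limit (R : realType) (n : nat) (u : nat -> 'rV[R]_n) (A q : R) :
  0 <= q -> q < 1 -> (forall k, `|u k.+1 - u k| <= A * q ^+ k) ->
  exists l, forall k, `|u k - l| <= A / (1 - q) * q ^+ k.
Proof.
move=> q0 q1 uA.
have A0 : 0 <= A by have := le_trans (normr_ge0 _) (uA 0); rewrite expr0 mulr1.
have /choice[l ll] : forall i, exists l, forall k,
    `|u k 0 i - l| <= A / (1 - q) * q ^+ k.
  move=> i; apply: geometric_limit => // k; apply: le_trans (uA k).
  by have := coord_le_norm (u k.+1 - u k) i; rewrite !mxE.
exists (\row_i l i) => k; apply: row_norm_le.
  by rewrite mulr_ge0 ?exprn_ge0// divr_ge0//; lra.
by move=> i; rewrite !mxE.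
Qed.

Section Relaxation.
Context {R : realType} {n : nat}.
Local Notation V := 'rV[R]_n.

Definition relaxation (K : R) (g z : R -> V) : Prop :=
  forall t : R, is_derive t 1 z (K *: (g t - z t)).

Lemma row_relaxation (K B : R) (g : R -> V) : 0 < K -> continuous g ->
  (forall t, `|g t| <= B) ->
  exists2 z, relaxation K g z & forall t, `|z t| <= B.
Proof.
move=> K0 cg gB; have B0 : 0 <= B := le_trans (normr_ge0 _) (gB 0).
have /choice[z zP] : forall i : 'I_n, exists z : R -> R,
    (forall t : R, is_derive t 1 z (K * (g t 0 i - z t))) /\ forall t, `|z t| <= B.
  move=> i; apply: bounded_relaxation => // [|t].
    move=> t; apply/continuous_distP => e e0.
    have /continuous_distP/(_ _ e0)[d d0 gd] := cg t.
    exists d => // s /gd; apply: le_lt_trans.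
    by have := coord_le_norm (g s - g t) i; rewrite !mxE.
  exact: le_trans (coord_le_norm _ _) (gB t).
exists (fun t => \row_i z i t) => t.
  apply/is_derive_row => i; rewrite !mxE.
  have -> : (fun s => (\row_i z i s) 0 i) = z i by apply/funext => s; rewrite mxE.
  exact: (zP i).1.
by apply: row_norm_le => // i; rewrite mxE; exact: (zP i).2.
Qed.

(** The difference is a bounded relaxation of [g - g']. Young's inequality bounds the derivative of
    its form by -K times the excess over [rho], so boundedness in the past excludes an excess. *)
Lemma relaxation_compare m (M : 'M[R]_(n, m)) (K rho B : R) (g g' z z' : R -> V) :
  0 < K -> relaxation K g z -> relaxation K g' z' ->
  (forall t, `|z t| <= B) -> (forall t, `|z' t| <= B) ->
  (forall t, gram M (g t - g' t) (g t - g' t) <= rho) ->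
  forall t, gram M (z t - z' t) (z t - z' t) <= rho.
Proof.
move=> K0 gz gz' zB zB' grho t; have [C C0 H] := gram_bound M.
have B0 : 0 <= B := le_trans (normr_ge0 _) (zB 0).
apply: (@backward_bounded_le _ (fun s => gram M (z s - z' s) (z s - z' s)) _ K rho
    (C * ((B + B) * (B + B))) (t + 1) K0).
- by move=> s _; apply: is_derive_gram_sub; [exact: gz | exact: gz'].
- move=> s _; have := gram_young M (g s - g' s) (z s - z' s) ltr01.
  have := grho s; rewrite invr1 !mul1r.
  have -> : K *: (g s - z s) - K *: (g' s - z' s) =
      K *: ((g s - g' s) - (z s - z' s)).
    by apply/rowP => i; rewrite !mxE; ring.
  rewrite gramZl (gramBl M (g s - g' s) (z s - z' s)).
  set a := gram M (g s - g' s) (g s - g' s).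
  set b := gram M (z s - z' s) (z s - z' s); set c := gram M (g s - g' s) _.
  move=> ab bc; have : K * (2 * c) <= K * (rho + b) by rewrite ler_pM2l//; lra.
  lra.
- move=> s _; apply: (le_trans (ler_norm _)); apply: (le_trans (H _ _)).
  have zz : `|z s - z' s| <= B + B by rewrite (le_trans (ler_normB _ _))// lerD.
  by rewrite ler_pM2l//; apply: ler_pM.
by rewrite ltrDl.
Qed.

End Relaxation.

(** * The bounded solution near an attracting equilibrium *)

Section Pullback.
Context {R : realType} {n : nat}.
Local Notation V := 'rV[R]_n.
Variables (U : set V) (f : V -> R -> V).
Hypothesis (openU : open U).
Hypothesis f_C2 : @Ck R (V * R)%type V 2 (U `*` [set: R]) (fun p => f p.1 p.2).

(** Expand the square: the cross term gives -2 c / K, and the quadratic term is at most c / K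
    because of [C ^+ 4 <= c * K]. *)
Lemma euler_contraction p l m (M : 'M[R]_(n, m)) C c d K x y s :
  contracting U f p l M C c d -> 0 < K -> C ^+ 4 <= c * K ->
  `|x - p| < d -> `|y - p| < d -> `|s - l| < d ->
  let G z := z + K^-1 *: f z s in
  gram M (G x - G y) (G x - G y) <= (1 - c / K) * gram M (x - y) (x - y).
Proof.
case=> [[C0 c0 d0] H1 H2 H3] K0 CK xp yp sl /=.
have [_ contr lip] := H3 x y s s xp yp sl sl.
rewrite subrr normr0 addr0 in lip.
set w := x - y in contr lip *; set g := f x s - f y s in contr lip *.
have -> : x + K^-1 *: f x s - (y + K^-1 *: f y s) = w + K^-1 *: g.
  by rewrite /w /g scalerBr opprD addrACA.
have gg : gram M g g <= C ^+ 4 * gram M w w.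
  apply: (le_trans (ler_norm _)); apply: (le_trans (H2 _ _)).
  have : `|g| * `|g| <= C * `|w| * (C * `|w|) by exact: ler_pM.
  rewrite -(ler_pM2l C0) => /le_trans; apply.
  have -> : C * (C * `|w| * (C * `|w|)) = C ^+ 3 * `|w| ^+ 2 by ring.
  have -> : C ^+ 4 * gram M w w = C ^+ 3 * (C * gram M w w) by ring.
  by rewrite ler_pM2l ?exprn_gt0.
rewrite gram_sqrD gramZr gramZl gramZr (gramC M w g).
have w0 := gram_ge0 M w.
have k0 : 0 < K^-1 by rewrite invr_gt0.
have h1 : K^-1 * gram M g w <= K^-1 * (- c * gram M w w) by rewrite ler_pM2l.
have h2 : K^-1 * (K^-1 * gram M g g) <= K^-1 * (c * gram M w w).
  rewrite ler_pM2l// ler_pdivrMl// mulrA; apply: (le_trans gg).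
  by rewrite ler_wpM2r// [K * c]mulrC.
lra.
Qed.

Lemma field_continuous p l m (M : 'M[R]_(n, m)) C c d (y : R -> V) (lam : R -> R) :
  contracting U f p l M C c d -> continuous y -> continuous lam ->
  (forall t, `|y t - p| < d) -> (forall t, `|lam t - l| < d) ->
  continuous (fun t => f (y t) (lam t)).
Proof.
case=> [[C0 c0 d0] H1 H2 H3] cy cl yp ll t; apply/continuous_distP => e e0.
have e2 : 0 < e / (2 * C) by rewrite divr_gt0// mulr_gt0.
have /continuous_distP/(_ _ e2)[d1 d10 Hy] := cy t.
have /continuous_distP/(_ _ e2)[d2 d20 Hl] := cl t.
exists (Num.min d1 d2) => [|s]; first by rewrite lt_min d10.
rewrite lt_min => /andP[/Hy h1 /Hl h2].
have [_ _ lip] := H3 (y s) (y t) (lam s) (lam t) (yp s) (yp t) (ll s) (ll t).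
apply: (le_lt_trans lip); rewrite -ltr_pdivlMl//.
have -> : C^-1 * e = e / (2 * C) + e / (2 * C) by field; rewrite gt_eqF.
exact: ltrD.
Qed.

Lemma uniform_limit_continuous (u : nat -> R -> V) (y : R -> V) (A q : R) :
  0 <= q -> q < 1 -> (forall k, continuous (u k)) ->
  (forall t k, `|u k t - y t| <= A * q ^+ k) -> continuous y.
Proof.
move=> q0 q1 cu uy t; apply/continuous_distP => e e0.
have e3 : 0 < e / 3 by rewrite divr_gt0.
have [k Hk] := geometric_small A q0 q1 e3.
have /continuous_distP/(_ _ e3)[d d0 ud] := cu k t.
exists d => // s /ud h; have h1 := uy s k; have h2 := uy t k.
rewrite distrC in h1; rewrite -(subrKA (u k s)) -(subrKA (u k t) (u k s)).
apply: (le_lt_trans (ler_normD _ _)).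
have := ler_normD (u k s - u k t) (u k t - y t); lra.
Qed.

(* The vector field is written as a relaxation x' = K (G(x, t) - x) towards the
   explicit Euler step G(x, t) = x + f(x, lam t) / K, which for large K is a
   contraction near the equilibrium; the bounded solution is its fixed point. *)
Lemma bounded_solution p l m (M : 'M[R]_(n, m)) C c d :
  contracting U f p l M C c d -> f p l = 0 ->
  exists2 eta, 0 < eta & forall lam : R -> R, continuous lam ->
    (forall t, `|lam t - l| < eta) ->
    exists x : R -> V, forall t,
      `|x t - p| < d /\ is_derive t 1 x (f (x t) (lam t)).
Proof.
move=> cM fp0; have [[C0 c0 d0] H1 H2 H3] := cM.
pose K := C ^+ 4 / c + c + 1.
have C4 : 0 < C ^+ 4 / c by rewrite divr_gt0 ?exprn_gt0.
have Kc : c < K by rewrite /K; lra.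
have K0 : 0 < K by lra.
have CK : C ^+ 4 <= c * K.
  have -> : c * K = C ^+ 4 + c * (c + 1) by rewrite /K; field; rewrite gt_eqF.
  by rewrite lerDl; apply: mulr_ge0; lra.
pose th := 1 - c / K.
have cK1 : 0 < c / K < 1 by rewrite divr_gt0//= ltr_pdivrMr// mul1r.
have th01 : 0 < th < 1 by rewrite /th; lra.
have /andP[th0 th1] := th01.
(* [th] contracts the squared form, so distances contract at rate [q]. *)
pose q := Num.sqrt th.
have q0 : 0 <= q by exact: sqrtr_ge0.
have q1 : q < 1 by rewrite -sqrtr1 ltr_sqrt.
have qq : q ^+ 2 = th by rewrite sqr_sqrtr// ltW.
have d2 : 0 < d / 2 by rewrite divr_gt0.
pose rho := (d / 2) ^+ 2 / (2 * C).
have rho0 : 0 < rho by rewrite divr_gt0 ?exprn_gt0 ?mulr_gt0.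
have small (v : V) : gram M v v <= rho -> `|v| < d / 2.
  move=> vq; apply: normr_lt_sqr => //; apply: le_lt_trans (H1 v) _.
  apply: (@le_lt_trans _ _ (C * rho)); first by rewrite ler_pM2l.
  have -> : C * rho = (d / 2) ^+ 2 / 2 by rewrite /rho; field; rewrite gt_eqF.
  by have := exprn_gt0 2 d2; lra.
(* The weight for Young's inequality that keeps the sublevel [rho] invariant: th rho + 2 e rho = rho
   (step [h11]). *)
pose e := (1 - th) / 2.
have e0 : 0 < e by rewrite /e; lra.
have C3 : 0 < (1 + e^-1) * C ^+ 3 / K ^+ 2.
  by rewrite divr_gt0 ?exprn_gt0// mulr_gt0 ?exprn_gt0// addr_gt0 ?invr_gt0.
have qe : 0 < e * rho / ((1 + e^-1) * C ^+ 3 / K ^+ 2).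
  by rewrite divr_gt0// mulr_gt0.
have [eta eta0 /and4P[eta1 etad etar _]] := @small_positive _
  [:: 1; d; e * rho / ((1 + e^-1) * C ^+ 3 / K ^+ 2)] ltac:(by rewrite /= ltr01 d0 qe).
rewrite ltr_pdivlMr// in etar.
exists eta => // lam clam lamP.
have lamd (t : R) : `|lam t - l| < d := lt_trans (lamP t) etad.
pose G (y : R -> V) t := y t + K^-1 *: f (y t) (lam t).
have z0 (W : normedModType R) (v : W) : `|v - v| < d by rewrite subrr normr0.
pose P (y : R -> V) := continuous y /\ forall t, gram M (y t - p) (y t - p) <= rho.
have Pd (y : R -> V) (t : R) : P y -> `|y t - p| < d.
  by move=> [_ /(_ t)/small]; lra.
have Gc (y : R -> V) : continuous y -> (forall t, `|y t - p| < d) -> continuous (G y).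
  move=> cy yd t; rewrite /G; apply: cvgD; first exact: cy.
  apply: cvgZ; first exact: cvg_cst.
  exact: (field_continuous cM cy clam yd lamd).
have Gb (y : R -> V) (t : R) : (forall t, `|y t - p| < d) -> `|G y t| <= `|p| + d + K^-1 * (C * (d + d)).
  move=> yd; have [_ _] := H3 (y t) p (lam t) l (yd t) (z0 _ _) (lamd t) (z0 _ _).
  rewrite fp0 subr0 => lip; rewrite (le_trans (ler_normD _ _))// lerD//.
    rewrite -(subrK p (y t)) addrC (le_trans (ler_normD _ _))// lerD2l ltW//.
  rewrite normrZ gtr0_norm ?invr_gt0// ler_pM2l ?invr_gt0//.
  by apply: (le_trans lip); rewrite ler_pM2l// lerD// ltW.
have Gp (y : R -> V) (t : R) : P y -> gram M (G y t - p) (G y t - p) <= rho.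
  move=> Py; have := euler_contraction cM K0 CK (Pd _ t Py) (z0 _ p) (lamd t) => /= h1.
  have -> : G y t - p = (G y t - (p + K^-1 *: f p (lam t))) + K^-1 *: f p (lam t).
    by rewrite opprD addrA subrK.
  move: h1; rewrite -/(G y t); set a := G y t - _; set b := K^-1 *: _ => h1.
  have young := gram_young M a b e0.
  have h3 := Py.2 t; have a0 := gram_ge0 M a.
  have h4 : gram M a a <= th * rho.
    by apply: (le_trans h1); rewrite -/th ler_pM2l.
  have h5 : gram M b b <= C ^+ 3 / K ^+ 2 * eta.
    rewrite /b gramZl gramZr.
    have [_ _] := H3 p p (lam t) l (z0 _ _) (z0 _ _) (lamd t) (z0 _ _).
    rewrite fp0 subr0 subrr normr0 add0r => lip.
    have lip' : `|f p (lam t)| <= C * eta.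
      by apply: (le_trans lip); rewrite ler_pM2l// ltW.
    have h6 : gram M (f p (lam t)) (f p (lam t)) <= C * (C * eta * (C * eta)).
      apply: (le_trans (ler_norm _)); apply: (le_trans (H2 _ _)).
      by rewrite ler_pM2l//; apply: ler_pM.
    have h7 : C * (C * eta * (C * eta)) <= C ^+ 3 * eta.
      have -> : C * (C * eta * (C * eta)) = C ^+ 3 * (eta * eta) by ring.
      by rewrite ler_pM2l ?exprn_gt0// ger_pMl// ltW.
    have -> : C ^+ 3 / K ^+ 2 * eta = K^-1 * (K^-1 * (C ^+ 3 * eta)).
      by field; rewrite gt_eqF.
    by rewrite !ler_pM2l ?invr_gt0// (le_trans h6).
  have e10 : 0 < 1 + e^-1 by rewrite addr_gt0 ?invr_gt0.
  have h8 : (1 + e^-1) * gram M b b <= e * rho.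
    apply: (@le_trans _ _ ((1 + e^-1) * (C ^+ 3 / K ^+ 2 * eta))).
      by rewrite ler_pM2l.
    by rewrite mulrA mulrC (mulrA (1 + e^-1)); exact: ltW.
  have h9 : (1 + e) * gram M a a <= (1 + e) * (th * rho).
    by rewrite ler_pM2l// addr_gt0.
  have h10 : e * (th * rho) <= e * rho.
    by rewrite ler_pM2l// ger_pMl// ltW.
  have h11 : th * rho + e * rho + e * rho = rho by rewrite /e; field.
  rewrite gram_sqrD; lra.
have step (y : {y | P y}) : exists z : {z | P z}, relaxation K (G (sval y)) (sval z).
  case: y => y Py /=.
  have yd (t : R) := Pd _ t Py.
  have [z zr zb] := row_relaxation K0 (Gc _ Py.1 yd) (fun t => Gb y t yd).
  have Pz : P z.
    split=> [t|t]; first exact: is_derive_continuous (zr t).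
    apply: (relaxation_compare (z' := fun=> p) (g' := fun=> p) K0 zr _ zb) => [s|s|s].
    - by rewrite subrr scaler0; exact: is_derive_cst.
    - by rewrite -addrA lerDl addr_ge0 ?(ltW d0)// mulr_ge0 ?invr_ge0 ?(ltW K0)//
        mulr_ge0 ?(ltW C0)// addr_ge0// ltW.
    - exact: Gp.
  by exists (exist _ z Pz).
have [next nextP] := choice step.
have Pp : P (fun=> p).
  split=> t; first exact: cst_continuous.
  by rewrite subrr gram0l ltW.
pose ys k := iter k next (exist _ _ Pp).
pose u k := sval (ys k).
have uP k : P (u k) by exact: (svalP (ys k)).
have ud k (t : R) : `|u k t - p| < d by exact: Pd.
have uS k : relaxation K (G (u k)) (u k.+1) by exact: nextP.
pose B := `|p| + d.
have uB k t : `|u k t| <= B.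
  rewrite -(subrK p (u k t)) addrC (le_trans (ler_normD _ _))// lerD2l.
  exact/ltW/ud.
have ugram k t : gram M (u k.+1 t - u k t) (u k.+1 t - u k t) <= th ^+ k * rho.
  elim: k t => [|k IH] t; first by rewrite expr0 mul1r; exact: (uP 1%N).2.
  apply: (relaxation_compare K0 (uS k.+1) (uS k) (uB _) (uB _)) => s.
  apply: (le_trans (euler_contraction cM K0 CK (ud _ _) (ud _ _) (lamd s))).
  by rewrite -/th exprS -mulrA ler_pM2l.
(* The summand 1 ensures [C * rho <= A ^+ 2]. *)
pose A := 1 + C * rho.
have Crho : 0 < C * rho by rewrite mulr_gt0.
have A0 : 0 <= A by rewrite /A; lra.
have udist (t : R) k : `|u k.+1 t - u k t| <= A * q ^+ k.
  rewrite -(@ler_pXn2r _ 2)// ?nnegrE ?mulr_ge0 ?exprn_ge0//.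
  apply: (le_trans (H1 _)); apply: (@le_trans _ _ (C * (th ^+ k * rho))).
    by rewrite ler_pM2l.
  rewrite exprMn -exprM mulnC exprM qq mulrCA mulrC ler_wpM2r ?exprn_ge0 ?(ltW th0)//.
  by rewrite /A expr2; nra.
have /choice[y yP] : forall t, exists l, forall k, `|u k t - l| <= A / (1 - q) * q ^+ k.
  by move=> t; exact: row_geometric_limit.
pose A' := A / (1 - q).
have cy : continuous y.
  by apply: (uniform_limit_continuous q0 q1 (fun k => (uP k).1)) => t k; exact: yP.
have yd (t : R) : `|y t - p| < d.
  have [k Hk] := geometric_small A' q0 q1 d2.
  have h1 := yP t k; have h2 := small _ ((uP k).2 t).
  rewrite distrC in h1; rewrite -(subrKA (u k t)) (le_lt_trans (ler_normD _ _))//.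
  by move: Hk; rewrite /A'; lra.
(* To pass to the limit in the equation, relax towards [G y] and show that [z] is also the limit of
   the iterates. *)
have [z zr zb] := row_relaxation K0 (Gc _ cy yd) (fun t => Gb y t yd).
suff zy : z = y.
  exists y => t; split=> //; have := zr t; rewrite zy /G.
  by rewrite addrAC subrr add0r scalerA divff ?scale1r// gt_eqF.
apply/funext => t; apply: eq_of_dist => ep ep0.
have [k Hk] := geometric_small ((C + 1) * A') q0 q1 ep0.
pose ek := A' * q ^+ k.
have ek0 : 0 <= ek by rewrite mulr_ge0 ?exprn_ge0// divr_ge0//; lra.
have zu : `|z t - u k.+1 t| <= C * ek.
  have Cek : 0 <= C * ek by exact: mulr_ge0 (ltW C0) ek0.
  rewrite -(@ler_pXn2r _ 2)// ?nnegrE//.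
  apply: (le_trans (H1 _)); rewrite exprMn [C ^+ 2]expr2 -mulrA ler_pM2l//.
  pose B' := `|p| + d + K^-1 * (C * (d + d)).
  have BB' : B <= B'.
    by rewrite lerDl mulr_ge0 ?invr_ge0 ?(ltW K0)// mulr_ge0 ?(ltW C0)// addr_ge0// ltW.
  apply: (relaxation_compare K0 zr (uS k) zb (fun s => le_trans (uB _ s) BB')) => s.
  apply: (le_trans (euler_contraction cM K0 CK (yd _) (ud _ _) (lamd s))).
  rewrite -/th; have g0 := gram_ge0 M (y s - u k s).
  apply: (@le_trans _ _ (gram M (y s - u k s) (y s - u k s))).
    by apply: ler_piMl => //; exact: ltW.
  apply: (le_trans (ler_norm _)); apply: (le_trans (H2 _ _)).
  by rewrite ler_pM2l// expr2 distrC; apply: ler_pM => //; exact: yP.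
have uy : `|u k.+1 t - y t| <= ek.
  apply: (le_trans (yP t k.+1)); rewrite /ek -/A' exprS mulrCA.
  by apply: ler_piMl => //; exact: ltW.
rewrite -(subrKA (u k.+1 t)) (le_lt_trans (ler_normD _ _))//.
have : (C + 1) * A' * q ^+ k = C * ek + ek by rewrite /ek; ring.
lra.
Qed.

End Pullback.

Lemma ereal_lt_near (R : realType) (T : \bar R) (u : R) : (u%:E < T)%E ->
  exists2 e, 0 < e & forall t, `|t - u| < e -> (t%:E < T)%E.
Proof.
case: T => [r| |]//= uT.
  rewrite lte_fin in uT; exists (r - u); first by rewrite subr_gt0.
  by move=> t /ltr_normlP[_]; rewrite lte_fin; lra.
by exists 1 => // t _; rewrite ltry.
Qed.

Lemma ereal_lt_ninfty (R : realType) (T : \bar R) : (-oo < T)%E ->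
  exists M : R, forall t, t <= M -> (t%:E < T)%E.
Proof.
case: T => [r| |]//= _.
  by exists (r - 1) => t tr; rewrite lte_fin; lra.
by exists 0 => t _; rewrite ltry.
Qed.

(** * Existence of the pullback attractor *)

Section MaximalPullback.
Context {R : realType} {n : nat}.
Local Notation V := 'rV[R]_n.
Variables (U : set V) (f : V -> R -> V).
Hypothesis (openU : open U).
Hypothesis f_C2 : @Ck R (V * R)%type V 2 (U `*` [set: R]) (fun p => f p.1 p.2).

(** [bounded_solution] gives a solution near [p], not its limit. At early times the parameter is as
    close to [l] as desired, and [lyapunov_decay] with [backward_bounded_le] squeezes the form
    accordingly. *)
Lemma pullback_local p l (lam : R -> R) : attracting_equilibrium U f p l ->
  continuous lam -> lam t @[t --> -oo] --> l ->
  exists (t0 : R) (x : R -> V),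
    trajectory U (fun y t => f y (lam t)) -oo%E t0%:E x /\ x t @[t --> -oo] --> p.
Proof.
move=> attp clam /cvg_ninfty_distP lamP; have [_ fp0 _] := attp.
have [m [M [C [c [d cM]]]]] := attracting_contracting openU f_C2 attp.
have [[C0 c0 d0] H1 H2 H3] := cM.
have [eta eta0 Heta] := bounded_solution cM fp0.
have [eta' eta'0 /and3P[etae etad _]] := @small_positive _ [:: eta; d]
  ltac:(by rewrite /= eta0 d0).
have [T HT] := lamP _ eta'0.
(* Freezing the parameter after [T] keeps it near [l] for all times; before [T] the equation is
   unchanged. *)
pose lam' t := lam (Num.min t T).
have lamd t : `|lam' t - l| < eta'.
  by apply: HT; rewrite ge_min lexx orbT.
have [|t|x xP] := Heta lam'; last 1 first.
- exists T, x; split.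
    move=> t _; rewrite lte_fin => tT; have [xd dx] := xP t.
    have [Ux _ _] := H3 (x t) p (lam' t) l xd (ltac:(by rewrite subrr normr0))
      (lt_trans (lamd t) etad) (ltac:(by rewrite subrr normr0)).
    by split=> //; move: dx; rewrite /lam' min_l// ltW.
  apply/cvg_ninfty_distP => e e0.
  have k0 : 0 < e ^+ 2 * c ^+ 2 / C ^+ 4.
    by rewrite divr_gt0 ?mulr_gt0 ?exprn_gt0.
  have [dl dl0 /and4P[dl1 dld dle _]] := @small_positive _
    [:: 1; d; e ^+ 2 * c ^+ 2 / C ^+ 4] ltac:(by rewrite /= ltr01 d0 k0).
  have [T1 HT1] := lamP _ dl0.
  pose T2 := Num.min T T1.
  have T2T : T2 <= T by rewrite ge_min lexx.
  have T2T1 : T2 <= T1 by rewrite ge_min lexx orbT.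
  (* The value of the form at which decay and forcing balance in [lyapunov_decay]. *)
  pose mm := C ^+ 3 / c ^+ 2 * dl ^+ 2.
  exists (T2 - 1) => t tT2; apply: normr_lt_sqr => //.
  apply: (le_lt_trans (H1 _)).
  apply: (@le_lt_trans _ _ (C * mm)); last first.
    rewrite /mm; apply: (@le_lt_trans _ _ (C ^+ 4 / c ^+ 2 * dl)).
      have -> : C * (C ^+ 3 / c ^+ 2 * dl ^+ 2) = C ^+ 4 / c ^+ 2 * (dl * dl) by ring.
      by rewrite ler_pM2l ?divr_gt0 ?exprn_gt0// ger_pMl// ltW.
    rewrite ltr_pdivlMr ?exprn_gt0// in dle.
    rewrite mulrAC ltr_pdivrMr ?exprn_gt0// mulrC; exact: dle.
  rewrite ler_pM2l//.
  apply: (@backward_bounded_le _ (fun s => gram M (x s - p) (x s - p)) _ c mm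
    (C * (d * d)) T2 c0).
  - by move=> s _; apply: is_derive_gram_cst; exact: (xP s).2.
  - move=> s sT2; have [xd dx] := xP s.
    have sT : s <= T by rewrite ltW// (lt_le_trans sT2).
    have ls : `|lam' s - l| < dl.
      by rewrite /lam' min_l//; apply: HT1; rewrite ltW// (lt_le_trans sT2).
    apply: (le_trans (lyapunov_decay cM fp0 xd (lt_trans ls dld))).
    rewrite mulrBr !mulNr opprK lerD2l.
    have -> : c * mm = C ^+ 3 / c * dl ^+ 2 by rewrite /mm; field; rewrite gt_eqF.
    rewrite ler_pM2l ?divr_gt0 ?exprn_gt0// !expr2.
    by apply: ler_pM => //; exact: ltW.
  - move=> s _; have [xd _] := xP s; apply: (le_trans (ler_norm _)).
    apply: (le_trans (H2 _ _)); rewrite ler_pM2l//.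
    by apply: ler_pM => //; exact: ltW.
  - lra.
- move=> t; apply: (@continuous_comp _ _ _ (fun s => Num.min s T) lam); last exact: clam.
  by apply: continuous_min; [exact: cvg_id | exact: cvg_cst].
- exact: lt_trans (lamd t) etae.
Qed.

(* Zorn's lemma on the trajectories that emanate from p: comparable ones agree, so
   gluing them does not require uniqueness for the differential equation. *)
Lemma pullback_maximal p l (lam : R -> R) : attracting_equilibrium U f p l ->
  continuous lam -> lam t @[t --> -oo] --> l ->
  exists (T : \bar R) (x : R -> V),
    let F := fun y t => f y (lam t) in
    [/\ (-oo < T)%E, trajectory U F -oo%E T x, x t @[t --> -oo] --> p &
      forall (T' : \bar R) (y : R -> V), (T <= T')%E -> trajectory U F -oo%E T' y ->
        (forall t : R, (t%:E < T)%E -> y t = x t) -> T' = T].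
Proof.
move=> attp clam lamP; have [t0 [x0 [tr0 x0p]]] := pullback_local attp clam lamP.
pose F := fun (y : V) t => f y (lam t).
pose valid (s : \bar R * (R -> V)) := [/\ (-oo < s.1)%E, trajectory U F -oo%E s.1 s.2 &
  s.2 t @[t --> -oo] --> p].
pose S := {s | valid s}.
pose ext (s t : S) := `[< ((sval s).1 <= (sval t).1)%E /\
  forall u : R, (u%:E < (sval s).1)%E -> (sval t).2 u = (sval s).2 u >].
have v0 : valid (t0%:E, x0) by split; rewrite ?ltNyr.
have [||A totA|[[T x] [/= T0 trx xp]] maxx] := @ZL_preorder S (exist _ _ v0) ext.
- by move=> s; apply/asboolP; split.
- move=> r s t /asboolP[rs1 rs2] /asboolP[st1 st2]; apply/asboolP; split.
    exact: le_trans st1.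
  by move=> u ur; rewrite st2 ?rs2// (lt_le_trans ur).
- have [[s0 As0]|A0] := pselect (exists s, A s); last first.
    by exists (exist _ _ v0) => s As; case: A0; exists s.
  have /choice[xs xsP] : forall u : R, exists v, forall s, A s ->
      (u%:E < (sval s).1)%E -> v = (sval s).2 u.
    move=> u; have [[s [As us]]|nos] := pselect (exists s, A s /\ (u%:E < (sval s).1)%E).
      exists ((sval s).2 u) => s' As' us'.
      by have [/asboolP[_ ->]//|/asboolP[_ ->]//] := totA s s' As As'.
    by exists 0 => s As us; case: nos; exists s.
  pose Ts := ereal_sup [set (sval s).1 | s in A].
  have leTs s : A s -> ((sval s).1 <= Ts)%E by move=> As; apply: ereal_sup_ubound; exists s.
  have vs : valid (Ts, xs).
    have [s0T s0tr s0p] := svalP s0.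
    split=> /=; first exact: lt_le_trans (leTs _ As0).
      move=> u _ uTs.
      have [s [As us]] : exists s, A s /\ (u%:E < (sval s).1)%E.
        by have [_ [s As <-] us] := ereal_sup_gt uTs; exists s.
      have [_ str _] := svalP s.
      have [Us ds] := str u (ltNyr _) us.
      rewrite (xsP u s As us); split=> //.
      apply: near_eq_is_derive ds; have [e e0 He] := ereal_lt_near us.
      apply/nbhs_ballP; exists e => //= t; rewrite -ball_normE /ball_/= distrC => /He ts.
      by rewrite (xsP t s As ts).
    apply/cvg_ninfty_distP => e e0.
    have [M HM] := ereal_lt_ninfty s0T.
    have [T HT] := (cvg_ninfty_distP _ _).1 s0p e e0.
    exists (Num.min M T) => t; rewrite le_min => /andP[tM tT].
    by rewrite (xsP t s0 As0 (HM t tM)); exact: HT.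
  exists (exist _ _ vs) => s As; apply/asboolP; split=> /=; first exact: leTs.
  by move=> u us; exact: xsP.
exists T, x; split=> // T' y TT' try yx.
(* An extension agrees with [x] near -oo, hence inherits the limit and competes in the Zorn
   order. *)
have vy : valid (T', y).
  split=> //=; first exact: lt_le_trans TT'.
  apply/cvg_ninfty_distP => e e0.
  have [M HM] := ereal_lt_ninfty T0.
  have [T1 HT1] := (cvg_ninfty_distP _ _).1 xp e e0.
  exists (Num.min M T1) => t; rewrite le_min => /andP[tM tT].
  by rewrite yx ?HM//; exact: HT1.
have /asboolP[/= T'T _] : ext (exist _ _ vy) (exist _ (T, x) (And3 T0 trx xp)).
  by apply: maxx; apply/asboolP.
by apply/le_anti; rewrite T'T TT'.
Qed.

End MaximalPullback.

(** * Stable paths and tipping *)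

Lemma Ck1_lipschitz_ninfty (R : realType) (L : R -> R) :
  @Ck R R R 1 setT L -> L^`()%classic s @[s --> -oo] --> (0 : R) ->
  exists a, forall s t, s <= a -> t <= a -> `|L s - L t| <= 1 * `|s - t|.
Proof.
move=> [dL _] /cvg_ninfty_distP L'0; have [a Ha] := L'0 1 ltr01.
have Ld (t : R) : is_derive t 1 L (L^`()%classic t).
  by rewrite derive1E; apply: derivableP; apply: diff_derivable; exact: dL.
exists a.
have main s t : s <= t -> t <= a -> `|L s - L t| <= 1 * `|s - t|.
  move=> st ta; have [c /andP[sc ct]] := MVT_is_derive st (fun t _ _ => Ld t).
  rewrite distrC [`|s - t|]distrC => ->; rewrite normrM ler_wpM2r//.
  by have := Ha c (le_trans ct ta); rewrite subr0 => /ltW.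
move=> s t sa ta; have [st|/ltW ts] := leP s t; first exact: main.
by rewrite distrC [`|s - t|]distrC; exact: main.
Qed.

(** * The start at time -oo, and failure of forward basin stability *)

Section StartAndStability.
Context {R : realType} {n : nat}.
Local Notation V := 'rV[R]_n.
Variables (U : set V) (f : V -> R -> V).
Hypothesis (openU : open U).
Hypothesis f_C2 : @Ck R (V * R)%type V 2 (U `*` [set: R]) (fun p => f p.1 p.2).
Local Notation attracting := (attracting_equilibrium U f).
Variables (L : R -> R) (X : R -> V) (lm : R) (Xm : V).
Hypothesis L_C1 : @Ck R R R 1 setT L.

(** Up to some [a] the whole path lies in one contracting region around X_-, with a uniform
    Lipschitz constant, so [track_local] applies with an arbitrarily early left end. From [a] to [u]
    it is [track]. *)
Lemma track_start u e :
  L s @[s --> -oo] --> lm -> L^`()%classic s @[s --> -oo] --> (0 : R) ->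
  continuous X -> (forall s, attracting (X s) (L s)) ->
  X s @[s --> -oo] --> Xm -> attracting Xm lm -> 0 < e ->
  exists2 d, 0 < d & forall k c x t1, 0 < k -> k < d -> k * t1 + c = u ->
    (forall t : R, t <= t1 -> U (x t) /\ is_derive t 1 x (f (x t) (L (k * t + c)))) ->
    x t @[t --> -oo] --> Xm -> `|x t1 - X u| < e.
Proof.
move=> /cvg_ninfty_distP Llm L'0 cX attX /cvg_ninfty_distP XXm attXm e0.
have [m [M [C [c0 [d0 cM]]]]] := attracting_contracting openU f_C2 attXm.
have [[C0 c00 d00] _ _ _] := cM.
have d02 : 0 < d0 / 2 by rewrite divr_gt0.
have [a1 Ha1] := Ck1_lipschitz_ninfty L_C1 L'0.
have [a2 Ha2] := Llm _ d00.
have [a3 Ha3] := XXm _ d02.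
pose a := Num.min u (Num.min a1 (Num.min a2 a3)).
have au : a <= u by rewrite ge_min lexx.
have [aa1 aa2 aa3] : [/\ a <= a1, a <= a2 & a <= a3].
  by rewrite /a !ge_min !lexx !orbT.
have [d1 d10 H1] := track openU f_C2 L_C1 cX attX au e0.
pose K := C / c0 * (C * (C * 1)).
have K0 : 0 < K by rewrite mulr_gt0 ?divr_gt0// !mulr_gt0.
have [d2 d20 H2] := track_local cM cX attX K0 d10.
exists (Num.min d1 d2) => [|k c x t1 k0]; first by rewrite lt_min d10.
rewrite lt_min => /andP[kd1 kd2] t1u sol /cvg_ninfty_distP xXm.
pose ta := (a - c) / k.
have taE : k * ta + c = a by rewrite /ta; field; rewrite gt_eqF.
have tat1 : ta <= t1 by rewrite -(ler_pM2l k0); lra.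
have d22 : 0 < d2 / 2 by rewrite divr_gt0.
have [b1 Hb1] := xXm _ d22; have [b2 Hb2] := XXm _ d22.
(* Depends on [x]: so early that both the solution and the path are within [d2 / 2] of X_-. Only [d]
   has to be uniform. *)
pose tb := Num.min ta (Num.min b1 ((b2 - c) / k)).
have [tba tb1 tb2] : [/\ tb <= ta, tb <= b1 & tb <= (b2 - c) / k].
  by rewrite /tb !ge_min !lexx !orbT.
rewrite ler_pdivlMr// in tb2.
apply: (H1 k c x ta t1) => //; first by move=> t _ tt1; exact: sol.
have sub s : k * tb + c <= s <= a -> s <= a by case/andP.
apply: (H2 (k * tb + c) a _ k c x tb ta) => //.
- move=> s t /sub sa /sub ta'; split.
  + exact: Ha3 (le_trans sa aa3).
  + exact: Ha2 (le_trans sa aa2).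
  apply: (path_lipschitz cM attX) => //.
  + by have := Ha3 s (le_trans sa aa3); lra.
  + by have := Ha3 t (le_trans ta' aa3); lra.
  + exact: Ha2 (le_trans sa aa2).
  + exact: Ha2 (le_trans ta' aa2).
  + by apply: Ha1; [exact: le_trans aa1 | exact: le_trans aa1].
- by move=> t _ tta; apply: sol; exact: le_trans tat1.
have h1 := Hb1 tb tb1; have h2 : `|X (k * tb + c) - Xm| < d2 / 2 by apply: Hb2; lra.
rewrite distrC in h2; rewrite -(subrKA Xm) (le_lt_trans (ler_normD _ _))//; lra.
Qed.

Lemma fbs_basin_lt u s : forward_basin_stable U f L X -> u < s ->
  basin U f (X s) (L s) (X u).
Proof. by move=> fbs us; apply: (fbs s); apply: subset_closure; exists u. Qed.

(** The closure in [forward_basin_stable] puts X_- itself into every basin along the path. *)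
Lemma fbs_basin_ninfty s : forward_basin_stable U f L X ->
  X t @[t --> -oo] --> Xm -> basin U f (X s) (L s) Xm.
Proof.
move=> fbs XXm; apply: (fbs s) => B BXm.
have [a [_ Ha]] := XXm _ BXm.
exists (X (Num.min a s - 1)).
have [m1 m2] : Num.min a s <= a /\ Num.min a s <= s by rewrite !ge_min !lexx orbT.
split; last by apply: Ha; lra.
by exists (Num.min a s - 1) => //=; lra.
Qed.

Lemma not_fbs_crossing (Y : R -> V) (Xp Yp : V) u v :
  continuous X -> (forall s, attracting (X s) (L s)) -> X s @[s --> +oo] --> Xp ->
  continuous Y -> (forall s, attracting (Y s) (L s)) -> Y s @[s --> +oo] --> Yp ->
  Yp <> Xp -> u < v -> basin U f (Y v) (L v) (X u) ->
  ~ forward_basin_stable U f L X.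
Proof.
move=> cX attX /cvg_pinfty_distP XXp cY attY /cvg_pinfty_distP YYp YX uv bas fbs.
have XYv : X v = Y v.
  apply: (basin_unique openU f_C2 (attY v) bas).
  exact: fbs_basin_lt.
apply: YX; apply: eq_of_dist => e e0; have e2 : 0 < e / 2 by rewrite divr_gt0.
have [a1 Ha1] := XXp _ e2; have [a2 Ha2] := YYp _ e2.
pose a := Num.max v (Num.max a1 a2).
have [va a1a a2a] : [/\ v <= a, a1 <= a & a2 <= a].
  by rewrite /a !le_max !lexx !orbT.
have h1 := Ha1 a a1a; have h2 := Ha2 a a2a.
rewrite (stable_path_eq openU f_C2 L_C1 cX attX cY attY va XYv) in h1.
by rewrite distrC in h2; rewrite -(subrKA (Y a)) (le_lt_trans (ler_normD _ _))//; lra.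
Qed.

(** Forward basin stability would put X_- into the basin of each [X a]. For large [a] the parameter
    is near [lp], so [settle_limit] brings [X a] close to Y_+, which forces X_+ = Y_+. *)
Lemma not_fbs_limit lp (Xp Yp : V) :
  L s @[s --> +oo] --> lp -> X s @[s --> -oo] --> Xm -> X s @[s --> +oo] --> Xp ->
  Yp <> Xp -> attracting Yp lp -> basin U f Yp lp Xm ->
  ~ forward_basin_stable U f L X.
Proof.
move=> /cvg_pinfty_distP Llp XXm /cvg_pinfty_distP XXp YX attYp bas fbs.
apply: YX; apply/esym; apply: eq_of_dist => e e0; have e2 : 0 < e / 2 by rewrite divr_gt0.
have [a1 Ha1] := XXp _ e2.
have [d d0 H] := settle_limit openU f_C2 attYp bas e2.
have [a2 Ha2] := Llp _ d0.
pose a := Num.max a1 a2.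
have [a1a a2a] : a1 <= a /\ a2 <= a by rewrite !le_max !lexx !orbT.
have h1 := Ha1 a a1a.
have h2 := H (X a) (L a) (Ha2 a a2a) (fbs_basin_ninfty a fbs XXm).
by rewrite distrC in h1; rewrite -(subrKA (X a)) (le_lt_trans (ler_normD _ _))//; lra.
Qed.

End StartAndStability.

(** * Re-scalings of class C^2 *)

Section TwiceDifferentiable.
Context {R : realType}.
Implicit Types g h : R -> R.

Lemma Ck2_intro g (g1 g2 : R -> R) :
  (forall t : R, is_derive t 1 g (g1 t)) -> (forall t : R, is_derive t 1 g1 (g2 t)) ->
  continuous g2 -> @Ck R R R 2 setT g.
Proof.
move=> dg dg1 cg2.
have dir h h1 (v : R) : (forall t : R, is_derive t 1 h (h1 t)) ->
    (forall t, differentiable h t) /\ 'D_v h = (fun t => v * h1 t).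
  move=> dh; have hd t : differentiable h t.
    by apply/derivable1_diffP; case: (dh t).
  split=> //; apply/funext => t; rewrite deriveE//.
  rewrite -[v in LHS]mulr1 -[_ * 1]/(v *: 1) linearZ/= -deriveE//.
  by have [_ ->] := dh t.
split=> [t _|v]; first exact: (dir g g1 0 dg).1.
rewrite (dir g g1 v dg).2.
have dvg1 (t : R) : is_derive t 1 (fun t => v * g1 t) (v * g2 t).
  by have ? := dg1 t; apply: is_derive_eq; rewrite /GRing.scale/=; ring.
split=> [t _|w]; first exact: (dir _ _ 0 dvg1).1.
rewrite (dir _ _ w dvg1).2 => t _.
apply: cvgM; first exact: cvg_cst.
by apply: cvgM; [exact: cvg_cst | exact: cg2].
Qed.

Lemma Ck2_elim g : @Ck R R R 2 setT g -> exists g1 g2 : R -> R,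
  [/\ forall t : R, is_derive t 1 g (g1 t), forall t : R, is_derive t 1 g1 (g2 t) &
      continuous g2].
Proof.
case=> dg /(_ 1)[dg1 /(_ 1) cg2].
exists ('D_1 g), ('D_1 ('D_1 g)); split=> t.
- by apply: derivableP; apply: diff_derivable; exact: dg.
- by apply: derivableP; apply: diff_derivable; exact: dg1.
- exact: cg2.
Qed.

Lemma is_derive_pos_sqr (t : R) :
  is_derive t 1 (fun s => Num.max s 0 ^+ 2) (2 * Num.max t 0).
Proof.
apply/is_derive_distP => e e0; exists e => // s st.
rewrite /GRing.scale/=.
have sq : `|s - t| * `|s - t| = (s - t) ^+ 2 by rewrite -normrM -expr2 ger0_norm ?sqr_ge0.
have key : `|Num.max s 0 ^+ 2 - Num.max t 0 ^+ 2 - (s - t) * (2 * Num.max t 0)| <=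
    `|s - t| * `|s - t|.
  rewrite sq ler_norml; case: (leP s 0) => s0; case: (leP t 0) => t0;
    rewrite ?expr0n/= ?mulr0 ?subr0 !expr2; apply/andP; split; nra.
by apply: (le_trans key); rewrite ler_wpM2r// ltW.
Qed.

(** The normalised antiderivative of the bump [b], the product of the squared positive parts of t
    and w - t. The bump is of class C^1, so the step is of class C^2. *)
Lemma smooth_step (w : R) : 0 < w -> exists h h1 h2 : R -> R,
  [/\ forall t : R, is_derive t 1 h (h1 t), forall t : R, is_derive t 1 h1 (h2 t),
      continuous h2, exists B, forall t, 0 <= h1 t <= B &
      (forall t, t <= 0 -> h t = 0) /\ (forall t, w <= t -> h t = 1)].
Proof.
move=> w0.
pose m t : R := Num.max t 0; pose m2 t := m t ^+ 2.
pose b t := m2 t * m2 (w - t).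
have dm2 (t : R) : is_derive t 1 m2 (2 * m t) by exact: is_derive_pos_sqr.
have dm2' (t : R) : is_derive t 1 (fun t => m2 (w - t)) (- (2 * m (w - t))).
  have dw : is_derive t 1 (fun t => w - t) (-1).
    by apply: is_derive_eq; ring.
  have := @is_derive1_comp R m2 (fun t => w - t) t _ _ (dm2 (w - t)) dw.
  by rewrite mulrN1.
have db (t : R) : is_derive t 1 b (2 * m t * m2 (w - t) - m2 t * (2 * m (w - t))).
  have := dm2 t => d1; have := dm2' t => d2.
  apply: is_derive_eq; rewrite /GRing.scale/=; ring.
have cm : continuous m.
  by move=> t; apply: continuous_max; [exact: cvg_id | exact: cvg_cst].
have cmw : continuous (fun t => m (w - t)).
  move=> t; apply: (@continuous_comp _ _ _ (fun s => w - s) m); last exact: cm.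
  by apply: continuousB; [exact: cst_continuous | exact: cvg_id].
have cb t : {for t, continuous b} := is_derive_continuous (db t).
have [A dA] := antiderivative cb.
have b0 t : 0 <= b t by rewrite mulr_ge0 ?sqr_ge0.
have bl t : t <= 0 -> b t = 0.
  by move=> t0; rewrite /b /m2 /m max_r// expr0n mul0r.
have br t : w <= t -> b t = 0.
  by move=> tw; rewrite /b /m2 {2}/m max_r ?subr_le0// expr0n mulr0.
have Amono s t : s <= t -> A s <= A t.
  move=> st; have [c _] := MVT_is_derive st (fun t _ _ => dA t).
  by rewrite -subr_ge0 => ->; rewrite mulr_ge0 ?subr_ge0.
have A0w : A 0 < A w.
  have w3 : w / 3 <= w * 2 / 3 by lra.
  have [c /andP[c1 c2]] := MVT_is_derive w3 (fun t _ _ => dA t).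
  have bc : 0 < b c.
    rewrite mulr_gt0// exprn_gt0// /m lt_max; apply/orP; left; lra.
  have : 0 < b c * (w * 2 / 3 - w / 3) by rewrite mulr_gt0//; lra.
  move=> pos E; rewrite -E in pos.
  have : A 0 <= A (w / 3) by apply: Amono; lra.
  have : A (w * 2 / 3) <= A w by apply: Amono; lra.
  lra.
have const s t : s <= t -> (forall u, s <= u -> u <= t -> b u = 0) -> A s = A t.
  move=> st bu; have [c /andP[c1 c2]] := MVT_is_derive st (fun t _ _ => dA t).
  by rewrite bu// mul0r => /eqP; rewrite subr_eq0 => /eqP.
pose I := A w - A 0; have I0 : 0 < I by rewrite subr_gt0.
exists (fun t => (A t - A 0) / I), (fun t => b t / I),
  (fun t => (2 * m t * m2 (w - t) - m2 t * (2 * m (w - t))) / I).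
have In : I != 0 by rewrite gt_eqF.
split.
- move=> t; have ? := dA t; apply: is_derive_eq; rewrite /GRing.scale/=; ring.
- move=> t; have ? := db t; apply: is_derive_eq; rewrite /GRing.scale/=; ring.
- move=> t; apply: cvgM; last exact: cvg_cst.
  have c2 (u : R -> R) : continuous u -> continuous (fun t => 2 * u t).
    by move=> cu s; apply: cvgM; [exact: cvg_cst | exact: cu].
  have csq (u : R -> R) : continuous u -> continuous (fun t => u t ^+ 2).
    move=> cu s; have -> : (fun t => u t ^+ 2) = (fun t => u t * u t).
      by apply/funext => t'; rewrite expr2.
    by apply: cvgM; exact: cu.
  apply: cvgB; apply: cvgM.
  + exact: (c2 _ cm).
  + exact: (csq _ cmw).
  + exact: (csq _ cm).
  + exact: (c2 _ cmw).
- exists (w ^+ 2 * w ^+ 2 / I) => t; rewrite divr_ge0 ?(ltW I0)//=.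
  rewrite ler_pM2r ?invr_gt0//.
  have w40 : 0 <= w ^+ 2 * w ^+ 2 by rewrite mulr_ge0 ?sqr_ge0.
  have [/bl->//|t0] := leP t 0; have [/br->//|tw] := leP w t.
  rewrite /b /m2 /m !max_l ?subr_ge0 ?(ltW t0) ?(ltW tw)//.
  by apply: ler_pM; rewrite ?sqr_ge0// ler_pXn2r// ?nnegrE//; lra.
- split=> t t0.
    rewrite (const t 0 t0) ?subrr ?mul0r// => u _ u0.
    exact: bl.
  rewrite -(const w t t0) ?divff// => u wu _.
  exact: br.
Qed.

(** The bound on [s1] ensures that the derivative of the composite, [L1 (s t) * s1 t], still tends
    to 0 at both ends. *)
Lemma parameter_shift_rescale (lm lp : R) (L s s1 s2 : R -> R) (B : R) :
  parameter_shift lm lp L ->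
  (forall t : R, is_derive t 1 s (s1 t)) -> (forall t : R, is_derive t 1 s1 (s2 t)) ->
  continuous s2 -> (forall t, `|s1 t| <= B) ->
  s t @[t --> -oo] --> -oo -> s t @[t --> +oo] --> +oo ->
  parameter_shift lm lp (L \o s).
Proof.
move=> [L_C2 Lint Llm Llp [L'm L'p]] ds ds1 cs2 s1B sm sp.
have [L1 [L2 [dL dL1 cL2]]] := Ck2_elim L_C2.
have dLs (t : R) : is_derive t 1 (L \o s) (L1 (s t) * s1 t).
  exact: is_derive1_comp.
have cs t : {for t, continuous s} := is_derive_continuous (ds t).
have cs1 t : {for t, continuous s1} := is_derive_continuous (ds1 t).
have cL1 t : {for t, continuous L1} := is_derive_continuous (dL1 t).
have L1E t : L^`()%classic t = L1 t by rewrite derive1E; have [_ ->] := dL t.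
have LsE t : (L \o s)^`()%classic t = L1 (s t) * s1 t.
  by rewrite derive1E; have [_ ->] := dLs t.
have small (F : set_system R) : Filter F -> forall F' : set_system R,
    s t @[t --> F] --> F' -> L^`()%classic t @[t --> F'] --> (0 : R) ->
    (L \o s)^`()%classic t @[t --> F] --> (0 : R).
  move=> FF F' sF L'F; apply/cvgrPdist_lt => e e0.
  have B0 : 0 <= B := le_trans (normr_ge0 _) (s1B 0).
  have eB : 0 < e / (B + 1) by rewrite divr_gt0// ltr_wpDl.
  have L'F' : L^`()%classic (s t) @[t --> F] --> (0 : R).
    by apply: cvg_comp L'F; exact: sF.
  move/cvgrPdist_lt: L'F' => /(_ _ eB); apply: filterS => t.
  rewrite !sub0r !normrN LsE L1E ltr_pdivlMr ?ltr_wpDl// normrM => h.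
  by apply: le_lt_trans h; rewrite ler_wpM2l//; have := s1B t; lra.
split.
- apply: (Ck2_intro (g1 := fun t => L1 (s t) * s1 t)
    (g2 := fun t => L1 (s t) * s2 t + s1 t * (L2 (s t) * s1 t))) => // t.
    have dL1s : is_derive t 1 (fun t => L1 (s t)) (L2 (s t) * s1 t).
      exact: (is_derive1_comp (dL1 (s t)) (ds t)).
    have ? := ds1 t; apply: is_derive_eq; rewrite /GRing.scale/=; ring.
  apply: cvgD; apply: cvgM.
  + by apply: (@continuous_comp _ _ _ s L1); [exact: cs | exact: cL1].
  + exact: cs2.
  + exact: cs1.
  + apply: cvgM; last exact: cs1.
    by apply: (@continuous_comp _ _ _ s L2); [exact: cs | exact: cL2].
- by move=> t; exact: Lint.
- exact: cvg_comp sm Llm.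
- exact: cvg_comp sp Llp.
- by split; [exact: small sm L'm | exact: small sp L'p].
Qed.

End TwiceDifferentiable.

(** The clock k t + u plus [J] times a smooth step of width [w]: slope [k] outside the jump, and at
    least [k] inside. *)
Lemma stretched_jump (R : realType) (u J k w : R) : 0 < J -> 0 < k -> 0 < w ->
  exists s s1 s2 : R -> R,
    [/\ [/\ forall t : R, is_derive t 1 s (s1 t), forall t : R, is_derive t 1 s1 (s2 t),
          continuous s2 & exists B, forall t, `|s1 t| <= B],
        {homo s : t t' / t < t'},
        s t @[t --> -oo] --> -oo, s t @[t --> +oo] --> +oo &
        (forall t, t <= 0 -> s t = k * t + u) /\
        (forall t, w <= t -> s t = k * t + (u + J))].
Proof.
move=> J0 k0 /smooth_step[h [h1 [h2 [dh dh1 ch2 [B hB] [hl hr]]]]].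
pose s t : R := k * t + u + J * h t.
have ds (t : R) : is_derive t 1 s (k + J * h1 t).
  by have ? := dh t; apply: is_derive_eq; rewrite /GRing.scale/=; ring.
have sl t : t <= 0 -> s t = k * t + u by move=> t0; rewrite /s hl// mulr0 addr0.
have sr t : w <= t -> s t = k * t + (u + J).
  by move=> tw; rewrite /s hr// mulr1 addrA.
exists s, (fun t => k + J * h1 t), (fun t => J * h2 t); split=> //.
- split=> //.
  + by move=> t; have ? := dh1 t; apply: is_derive_eq; rewrite /GRing.scale/=; ring.
  + by move=> t; apply: cvgM; [exact: cvg_cst | exact: ch2].
  + exists (k + J * B) => t; have /andP[h10 h1B] := hB t.
    rewrite ger0_norm ?lerD2l ?ler_pM2l// addr_ge0 ?(ltW k0)//.
    by rewrite mulr_ge0// ltW.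
- move=> t t' tt'; have [c _] := MVT_is_derive (ltW tt') (fun t _ _ => ds t).
  have /andP[h10 _] := hB c.
  rewrite -subr_gt0 => ->; rewrite mulr_gt0 ?subr_gt0// ltr_pwDl//.
  by rewrite mulr_ge0// ltW.
- move=> P [M [_ HM]]; exists (Num.min 0 ((M - u) / k)); split; first exact: num_real.
  move=> t; rewrite lt_min => /andP[t0]; rewrite ltr_pdivlMr// => tM.
  by apply: HM; rewrite /= sl ?ltW//; lra.
- move=> P [M [_ HM]]; exists (Num.max w ((M - (u + J)) / k)); split; first exact: num_real.
  move=> t; rewrite gt_max => /andP[t0]; rewrite ltr_pdivrMr// => tM.
  by apply: HM; rewrite /= sr ?ltW//; lra.
Qed.

(** * R-tipping *)

Section Tipping.
Context {R : realType} {n : nat}.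
Local Notation V := 'rV[R]_n.
Variables (U : set V) (f : V -> R -> V).
Hypothesis (openU : open U).
Hypothesis f_C2 : @Ck R (V * R)%type V 2 (U `*` [set: R]) (fun p => f p.1 p.2).
Local Notation attracting := (attracting_equilibrium U f).

(** If the maximal time is finite there is nothing to show. Otherwise the trajectory is global and
    eventually closer to Y_+ than half the distance to X_+, so X_+ cannot be its limit. *)
Lemma R_tipping_of_escape (L : R -> R) (lm r : R) (Xm Xp Yp : V) :
  0 < r -> continuous L -> L s @[s --> -oo] --> lm -> attracting Xm lm -> Yp <> Xp ->
  (forall x : R -> V,
    (forall t : R, U (x t) /\ is_derive t 1 x (f (x t) (L (r * t)))) ->
    x t @[t --> -oo] --> Xm ->
    exists T, forall t, T <= t -> `|x t - Yp| < `|Yp - Xp| / 2) ->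
  R_tipping U f L Xm Xp.
Proof.
move=> r0 cL Llm attXm YX esc.
have clam : continuous (fun t => L (r * t)).
  move=> t; apply: (@continuous_comp _ _ _ (fun s => r * s) L); last exact: cL.
  by apply: cvgM; [exact: cvg_cst | exact: cvg_id].
have lamlm : L (r * t) @[t --> -oo] --> lm.
  apply/cvg_ninfty_distP => e e0; have [T HT] := (cvg_ninfty_distP _ _).1 Llm e e0.
  by exists (T / r) => t; rewrite ler_pdivlMr// mulrC; exact: HT.
have [T [x [T0 trx xXm xmax]]] := pullback_maximal openU f_C2 attXm clam lamlm.
exists r, T, x; split=> // -[Ty /cvg_pinfty_distP xXp].
have [|T1 HT1] := esc x _ xXm.
  by move=> t; apply: trx; rewrite ?ltNyr// Ty ltry.
have YX0 : 0 < `|Yp - Xp| / 2.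
  by rewrite divr_gt0// normr_gt0 subr_eq0; exact/eqP.
have [T2 HT2] := xXp _ YX0.
pose t := Num.max T1 T2.
have [t1 t2] : T1 <= t /\ T2 <= t by rewrite !le_max !lexx !orbT.
have h1 := HT1 t t1; have h2 := HT2 t t2; rewrite distrC in h1.
by have := ler_normD (Yp - x t) (x t - Xp); rewrite subrKA; lra.
Qed.

Variables (lm lp : R) (L : R -> R) (X : R -> V) (Xm Xp : V).
Hypothesis (lt_lm_lp : lm < lp) (shiftL : parameter_shift lm lp L).
Hypothesis (stableX : stable_path U f L lm lp X Xm Xp).

Lemma shift_C1 : @Ck R R R 1 setT L.
Proof.
case: shiftL => -[dL cL] _ _ _ _; split=> // v z _.
by apply: differentiable_continuous; exact: (cL v).1.
Qed.

Lemma shift_continuous : continuous L.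
Proof. by move=> t; apply: differentiable_continuous; apply: shift_C1.1. Qed.

Lemma R_tipping_limit (Yp : V) : Yp <> Xp -> attracting Yp lp -> basin U f Yp lp Xm ->
  R_tipping U f L Xm Xp.
Proof.
move=> YX attY bas; have [_ Lint Llm Llp _] := shiftL.
have [_ _ _ attXm _] := stableX; have [UXm _ _] := attXm.
have e0 : 0 < `|Yp - Xp| / 2.
  by rewrite divr_gt0// normr_gt0 subr_eq0; exact/eqP.
have [d1 [T [d10 T0 H1]]] := settle openU f_C2 attY bas e0.
have [d2 d20 H2] := short_time openU f_C2 UXm (ltW lt_lm_lp) d10.
have [d3 d30 H3] := trap openU f_C2 attXm d20.
have [a Ha] := (cvg_ninfty_distP _ _).1 Llm _ d30.
have [b0 Hb0] := (cvg_pinfty_distP _ _).1 Llp _ d10.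
pose b := Num.max a b0.
have [ab b0b] : a <= b /\ b0 <= b by rewrite !le_max !lexx !orbT.
(* The parameter argument crosses from [a] to [b] in time (b - a) / r < [d2], short enough for
   [short_time]. *)
pose r := (b - a) / d2 + 1.
have r0 : 0 < r by rewrite ltr_wpDl// divr_ge0 ?subr_ge0// ltW.
apply: (R_tipping_of_escape r0 shift_continuous Llm attXm YX) => x sol xXm.
have solx c d : solution U f x (fun t => L (r * t)) c d by move=> t _ _; exact: sol.
have [t' Ht'] := (cvg_ninfty_distP _ _).1 xXm _ d30.
pose t0 := Num.min t' (a / r).
have [t0t' t0a] : t0 <= t' /\ t0 <= a / r by rewrite !ge_min !lexx !orbT.
have xa : `|x (a / r) - Xm| < d2.
  apply: (H3 x _ t0 (a / r) (solx _ _)) => //; last exact: Ht'.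
  by move=> t _; rewrite ler_pdivlMr// mulrC; exact: Ha.
have xb : `|x (b / r) - Xm| < d1.
  apply: (H2 x _ (a / r) (b / r) (solx _ _)) => //.
  - by move=> t _ _; have /andP[l1 l2] := Lint (r * t); rewrite !ltW.
  - by rewrite ler_pM2r ?invr_gt0.
  - rewrite -mulrBl ltr_pdivrMr// /r mulrDr mulr1 mulrCA divff ?gt_eqF//.
    by rewrite mulr1 ltrDl.
exists (b / r + T); apply: (H1 x _ (b / r) (fun d => solx _ d)) => // t.
by rewrite ler_pdivrMr// mulrC => bt; apply: Hb0; exact: le_trans b0b bt.
Qed.

(** Each tolerance is the entry condition of the next phase: [d1] near Y_+, [d2] near Y(v), [d3]
    near X(u) after the jump, [d4] before it, and [d5] bounds the slow rate from -oo to [u]. *)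
Lemma R_tipping_crossing (Y : R -> V) (Ym Yp : V) u v :
  stable_path U f L lm lp Y Ym Yp -> Yp <> Xp -> u < v ->
  basin U f (Y v) (L v) (X u) ->
  exists L' : R -> R,
    [/\ parameter_shift lm lp L', rescaling L' L & R_tipping U f L' Xm Xp].
Proof.
case=> cY attY [_ YYp] _ attYp YX uv bas.
have [_ Lint Llm Llp [L'm _]] := shiftL.
have [cX attX [XXm _] attXm _] := stableX.
have e0 : 0 < `|Yp - Xp| / 2.
  by rewrite divr_gt0// normr_gt0 subr_eq0; exact/eqP.
have [d1 d10 H1] := trap openU f_C2 attYp e0.
have d12 : 0 < d1 / 2 by rewrite divr_gt0.
have [b1 Hb1] := (cvg_pinfty_distP _ _).1 YYp _ d12.
have [b2 Hb2] := (cvg_pinfty_distP _ _).1 Llp _ d10.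
pose b := Num.max v (Num.max b1 b2).
have [vb b1b b2b] : [/\ v <= b, b1 <= b & b2 <= b] by rewrite /b !le_max !lexx !orbT.
have [d2 d20 H2] := track openU f_C2 shift_C1 cY attY vb d12.
have [d3 [T [d30 T0 H3]]] := reach openU f_C2 bas d20.
have [UXu _ _] := attX u.
have [d4 d40 H4] := short_time openU f_C2 UXu (ltW lt_lm_lp) d30.
have [d5 d50 H5] := track_start openU f_C2 shift_C1 u Llm L'm cX attX XXm attXm d40.
have /continuous_distP/(_ _ d30)[rv rv0 Hrv] := @shift_continuous v.
have [w w0 /and3P[wd4 w1 _]] := @small_positive _ [:: d4; 1] ltac:(by rewrite /= d40 ltr01).
have T1 : 0 < T + 1 by rewrite ltr_wpDl.
have q1 : 0 < rv / (T + 1) by rewrite divr_gt0.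
have q2 : 0 < (v - u) / (T + 1) by rewrite divr_gt0// subr_gt0.
have [k k0 /and5P[kd5 kd2 krv kuv _]] := @small_positive _
  [:: d5; d2; rv / (T + 1); (v - u) / (T + 1)] ltac:(by rewrite /= d50 d20 q1 q2).
rewrite ltr_pdivlMr// in krv; rewrite ltr_pdivlMr// in kuv.
(* The jump stops short of [v], so that [s] equals [v] exactly at time [w + T], when the solution
   has come near Y(v). [krv] keeps the parameter argument within [rv] of [v] meanwhile, and [kuv]
   makes [J] positive. *)
pose J := v - u - k * (w + T).
have wT : k * (w + T) <= k * (T + 1) by rewrite ler_pM2l//; lra.
have J0 : 0 < J by rewrite /J; lra.
have [s [s1 [s2 [[ds ds1 cs2 [B s1B]] smono sm sp [sl sr]]]]] := stretched_jump u J0 k0 w0.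
have svE t : w <= t -> s t = k * t + (u + J) := sr t.
have L'shift : parameter_shift lm lp (L \o s).
  exact: (parameter_shift_rescale shiftL ds ds1 cs2 s1B sm sp).
exists (L \o s); split=> //.
  by exists s; split=> //; exact: (Ck2_intro ds ds1 cs2).
have [_ L'int L'lm _ _] := L'shift.
have cL' : continuous (L \o s).
  move=> t; apply: continuous_comp; last exact: shift_continuous.
  exact: is_derive_continuous (ds t).
(* The rate is 1: slow and fast phases are both built into [s]. *)
apply: (R_tipping_of_escape ltr01 cL' L'lm attXm YX) => x sol' xXm.
have sol t : U (x t) /\ is_derive t 1 x (f (x t) (L (s t))).
  by have := sol' t; rewrite mul1r.
have solx c d : solution U f x (fun t => L (s t)) c d by move=> t _ _; exact: sol.
have x0 : `|x 0 - X u| < d4.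
  apply: (H5 k u x 0) => //; first by rewrite mulr0 add0r.
  by move=> t t0; rewrite -sl.
have xw : `|x w - X u| < d3.
  apply: (H4 x _ 0 w (solx _ _)) => //; [|exact: ltW|by rewrite subr0].
  by move=> t _ _; have /andP[l1 l2] := Lint (s t); rewrite !ltW.
have xwT : `|x (w + T) - Y v| < d2.
  apply: (H3 x _ w (solx _ _)) => // t wt twT; apply: Hrv; rewrite svE//.
  have h1 : k * t <= k * (w + T) by rewrite ler_pM2l.
  have h2 : k * w <= k * t by rewrite ler_pM2l.
  have h3 : 0 < k * w by rewrite mulr_gt0.
  by rewrite /J ltr_norml; lra.
pose t1 := (b - (u + J)) / k.
have t1b : k * t1 + (u + J) = b by rewrite /t1; field; rewrite gt_eqF.
have wTt1 : w + T <= t1 by rewrite -(ler_pM2l k0); move: t1b; rewrite /J; lra.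
have xt1 : `|x t1 - Y b| < d1 / 2.
  apply: (H2 k (u + J) x (w + T)) => //; first by rewrite /J; ring.
  by move=> t wTt _; rewrite -svE; [exact: sol | lra].
have xt1' : `|x t1 - Yp| < d1.
  rewrite -(subrKA (Y b)) (le_lt_trans (ler_normD _ _))//.
  by have := Hb1 b b1b; lra.
exists t1 => t t1t.
apply: (H1 x _ t1 t (solx _ _)) => // t' t1t' _; apply: Hb2.
rewrite svE; last by lra.
have : k * t1 <= k * t' by rewrite ler_pM2l.
by lra.
Qed.

End Tipping.

Theorem theorem3p6 (R : realType) (n : nat) (U : set 'rV[R]_n)
    (f : 'rV[R]_n -> R -> 'rV[R]_n) (lm lp : R) (Lambda : R -> R)
    (X : R -> 'rV[R]_n) (Xm Xp : 'rV[R]_n)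
    (openU : open U)
    (f_C2 : @Ck R ('rV[R]_n * R)%type 'rV[R]_n 2 (U `*` [set: R])
              (fun p => f p.1 p.2))
    (lt_lm_lp : lm < lp)
    (shiftL : parameter_shift lm lp Lambda)
    (stableX : stable_path U f Lambda lm lp X Xm Xp) :
  ((exists (Y : R -> 'rV[R]_n) (Ym Yp : 'rV[R]_n),
      [/\ stable_path U f Lambda lm lp Y Ym Yp, Yp <> Xp &
          exists u v : R, u < v /\ basin U f (Y v) (Lambda v) (X u)]) ->
    ~ forward_basin_stable U f Lambda X /\
    exists Lambda' : R -> R,
      [/\ parameter_shift lm lp Lambda', rescaling Lambda' Lambda &
          R_tipping U f Lambda' Xm Xp])
  /\
  ((exists Yp : 'rV[R]_n,
      [/\ Yp <> Xp, attracting_equilibrium U f Yp lp &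
          basin U f Yp lp Xm]) ->
    ~ forward_basin_stable U f Lambda X /\ R_tipping U f Lambda Xm Xp).
Proof.
have L_C1 := shift_C1 shiftL.
have [cX attX [XXm XXp] attXm attXp] := stableX.
split=> [[Y [Ym [Yp [stableY YX [u [v [uv bas]]]]]]]|[Yp [YX attY bas]]]; split.
- have [cY attY [_ YYp] _ _] := stableY.
  exact: (not_fbs_crossing openU f_C2 L_C1 cX attX XXp cY attY YYp YX uv bas).
- exact: (R_tipping_crossing openU f_C2 lt_lm_lp shiftL stableX stableY YX uv bas).
- have [_ _ _ Llp _] := shiftL.
  exact: (not_fbs_limit openU f_C2 Llp XXm XXp YX attY bas).
- exact: (R_tipping_limit openU f_C2 lt_lm_lp shiftL stableX YX attY bas).
Qed.
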